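(* Let $X,Y,Z$ be finite random variables with joint distribution $P_{XYZ}$ that is private and bi-disjoint between $XY$ and $Z$ (definitions in the context). Then a secret key rate of $$I(X:Z)-I(X:Y)=H(X|Y)-H(X|Z)$$ is necessary and sufficient for distribution merging of $P_{XYZ}$ from Alice (holding $X$) to Bob (holding $Y$). That is, the infimum of the secret key rates of asymptotically successful distribution merging protocols equals $I(X:Z)-I(X:Y)$. In particular: - when this quantity is nonnegative, it is the minimum rate of secret key consumed by an optimal merging protocol; - when it is negative, distribution merging can be achieved while $I(X:Y)-I(X:Z)$ bits of secret key per copy remain at the end of the protocol, and no protocol leaves more.
   Context: Notation. $H$ is Shannon entropy (base 2), $H(X|Y)=H(XY)-H(Y)$, and $I(X:Y)=H(X)+H(Y)-H(XY)$ is the mutual information. Parties. Alice holds $X$, Bob holds $Y$, a reference party $R$ holds $Z$, and an eavesdropper $E$ holds a random variable $E$. The distribution is private: $P_{XYZE}=P_{XYZ}\otimes P_E$. Bi-disjointness. Write $T=XY$. The distribution $P_{TZ}$ is bi-disjoint if it can be written as $$P_{TZ}(t,z)=\sum_i p(i)\,P_{T|I=i}(t)\,P_{Z|I=i}(z)$$ for some probability distribution $p$ on labels $i$ and conditional distributions $P_{T|I}$, $P_{Z|I}$ satisfying $P_{T|I=i}(t)P_{T|I=j}(t)=0$ and $P_{Z|I=i}(z)P_{Z|I=j}(z)=0$ for all $t,z$ whenever $i\neq j$. Secret key. A secret key bit is the distribution $\overline\Psi_{UV}(0,0)=\overline\Psi_{UV}(1,1)=1/2$ shared by Alice ($U$)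 and Bob ($V$), independent of all other parties. Allowed operations (LOPC). These are local operations, meaning local randomness and local stochastic processing, together with public communication. The eavesdropper receives a copy of every public message. Distribution merging. Given $n$ i.i.d. copies $X^nY^nZ^nE^n$ of $P_{XYZE}$, a protocol may use $k$ bits of secret key plus free LOPC. At the end: - Alice holds $\widehat U^l$; - Bob holds $\widehat V^l\widehat X^n\widehat Y^n$; - the reference still holds $Z^n$; - the eavesdropper holds $\widehat E^n$. The protocol produces a joint distribution $P'_{\widehat U^l(\widehat X^n\widehat Y^n\widehat V^l)Z^n\widehat E^n}$, and it succeeds if $P'$ approximates $P_{XYZE}^{\otimes n}\otimes\overline\Psi_{UV}^{\otimes l}$ in total variation ($\ell^1$) distance, with error tending to $0$ as $n\to\infty$. Here $l$ is the number of secret key bits shared by Alice and Bob at the end. The secret key rate of the protocol is $\frac1n(k-l)$, which may be negative. A rate is achievable if there are successful protocols (error $\to0$ as $n\to\infty$) whose secret key rates approach it asymptotically. *)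

(* Defs.v *)
From HB Require Import structures.
From mathcomp Require Import all_boot all_order all_algebra.
From mathcomp Require Import all_classical all_reals all_analysis.
Set Implicit Arguments. Unset Strict Implicit. Unset Printing Implicit Defensive.
Import Order.TTheory GRing.Theory Num.Theory.
Import numFieldNormedType.Exports.
Local Open Scope classical_set_scope.
Local Open Scope ring_scope.

Section Defs.
Variable R : realType.

Definition is_dist (T : finType) (p : T -> R) : Prop :=
  (forall t, 0 <= p t) /\ \sum_(t : T) p t = 1.

(* base-2 logarithm; ln 0 = 0 in mathcomp-analysis, so 0 log 0 = 0 *)
Definition log2 (x : R) : R := ln x / ln 2.

Definition entropy (T : finType) (p : T -> R) : R :=
  - \sum_(t : T) p t * log2 (p t).

Variables X Y Z E : finType.

Definition margX (P : X -> Y -> Z -> R) (x : X) : R := \sum_(y : Y) \sum_(z : Z) P x y z.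
Definition margY (P : X -> Y -> Z -> R) (y : Y) : R := \sum_(x : X) \sum_(z : Z) P x y z.
Definition margZ (P : X -> Y -> Z -> R) (z : Z) : R := \sum_(x : X) \sum_(y : Y) P x y z.
Definition margXY (P : X -> Y -> Z -> R) (t : X * Y) : R := \sum_(z : Z) P t.1 t.2 z.
Definition margXZ (P : X -> Y -> Z -> R) (t : X * Z) : R := \sum_(y : Y) P t.1 y t.2.

Definition mi_XY (P : X -> Y -> Z -> R) : R :=
  entropy (margX P) + entropy (margY P) - entropy (margXY P).
Definition mi_XZ (P : X -> Y -> Z -> R) : R :=
  entropy (margX P) + entropy (margZ P) - entropy (margXZ P).
Definition condH_XgY (P : X -> Y -> Z -> R) : R := entropy (margXY P) - entropy (margY P).
Definition condH_XgZ (P : X -> Y -> Z -> R) : R := entropy (margXZ P) - entropy (margZ P).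

(* bi-disjointness of P_{TZ}, T = XY (finitely many labels suffice) *)
Definition bidisjoint (P : X -> Y -> Z -> R) : Prop :=
  exists (N : nat) (p : 'I_N -> R) (PT : 'I_N -> X * Y -> R) (PZ : 'I_N -> Z -> R),
    [/\ is_dist p, (forall i, is_dist (PT i)), (forall i, is_dist (PZ i)),
        (forall x y z, P x y z = \sum_(i < N) p i * PT i (x, y) * PZ i z) &
        (forall i j, i != j ->
           (forall t, PT i t * PT j t = 0) /\ (forall z, PZ i z * PZ j z = 0))].

Definition Pn (n : nat) (P : X -> Y -> Z -> R)
    (x : n.-tuple X) (y : n.-tuple Y) (z : n.-tuple Z) : R :=
  \prod_(i < n) P (tnth x i) (tnth y i) (tnth z i).
Definition PEn (n : nat) (PE : E -> R) (e : n.-tuple E) : R :=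
  \prod_(i < n) PE (tnth e i).

(* An LOPC protocol on n copies, using k bits of initial secret key and
   outputting l key bits.  Local randomness of Alice/Bob is drawn once at the
   start (RA, RB with distributions pA, pB); all later local processing is then
   a deterministic function of the party's whole view (input, key, private
   randomness, public transcript so far).  Round i (0 <= i < rounds) is spoken
   by Alice if speaker i, else by Bob; messages lie in 'I_msize. *)
Record protocol (n k l : nat) := Protocol {
  rounds : nat;
  msize : nat;
  RA : finType; pA : RA -> R; pA_dist : is_dist pA;
  RB : finType; pB : RB -> R; pB_dist : is_dist pB;
  speaker : nat -> bool;
  msgA : nat -> n.-tuple X -> k.-tuple bool -> RA -> seq 'I_msize -> 'I_msize;
  msgB : nat -> n.-tuple Y -> k.-tuple bool -> RB -> seq 'I_msize -> 'I_msize;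
  outA : n.-tuple X -> k.-tuple bool -> RA -> seq 'I_msize -> l.-tuple bool;
  outB : n.-tuple Y -> k.-tuple bool -> RB -> seq 'I_msize ->
           l.-tuple bool * (n.-tuple X * n.-tuple Y)
}.

Arguments msgA {n k l} p _ _ _ _ _.
Arguments msgB {n k l} p _ _ _ _ _.
Arguments outA {n k l} p _ _ _ _.
Arguments outB {n k l} p _ _ _ _.

Fixpoint trans (M : Type) (next : nat -> seq M -> M) (r : nat) : seq M :=
  match r with
  | 0 => [::]
  | r'.+1 => let s := trans next r' in rcons s (next r' s)
  end.

Definition transcript n k l (Pi : protocol n k l) (x : n.-tuple X) (y : n.-tuple Y)
    (key : k.-tuple bool) (ra : RA Pi) (rb : RB Pi) : seq 'I_(msize Pi) :=
  trans (fun i s => if speaker Pi i then msgA Pi i x key ra s else msgB Pi i y key rb s)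
        (rounds Pi).

(* final joint distribution P' of
   (Alice's U^l, Bob's V^l, Bob's Xhat^n Yhat^n, reference Z^n,
    eavesdropper's view = (E^n, public transcript)) *)
Definition out_prob n k l (Pi : protocol n k l) (P : X -> Y -> Z -> R) (PE : E -> R)
    (u v : l.-tuple bool) (xh : n.-tuple X) (yh : n.-tuple Y) (z : n.-tuple Z)
    (e : n.-tuple E) (t : (rounds Pi).-tuple 'I_(msize Pi)) : R :=
  \sum_(x : n.-tuple X) \sum_(y : n.-tuple Y) \sum_(key : k.-tuple bool)
  \sum_(ra : RA Pi) \sum_(rb : RB Pi)
    Pn P x y z * PEn PE e * (2 ^+ k)^-1 * pA ra * pB rb *
    (let s := transcript x y key ra rb in
     ((outA Pi x key ra s == u) && (outB Pi y key rb s == (v, (xh, yh)))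
      && (s == tval t))%:R).

(* ideal distribution P_{XYZE}^{(x)n} (x) Psi^{(x)l}, with the public transcript
   held by Eve decoupled from everything (distribution Q) *)
Definition ideal_prob n l (P : X -> Y -> Z -> R) (PE : E -> R) (r m : nat)
    (Q : r.-tuple 'I_m -> R)
    (u v : l.-tuple bool) (xh : n.-tuple X) (yh : n.-tuple Y) (z : n.-tuple Z)
    (e : n.-tuple E) (t : r.-tuple 'I_m) : R :=
  Pn P xh yh z * PEn PE e * ((u == v)%:R / 2 ^+ l) * Q t.

Definition merge_err n k l (Pi : protocol n k l) (P : X -> Y -> Z -> R) (PE : E -> R)
    (Q : (rounds Pi).-tuple 'I_(msize Pi) -> R) : R :=
  \sum_(u : l.-tuple bool) \sum_(v : l.-tuple bool) \sum_(xh : n.-tuple X)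
  \sum_(yh : n.-tuple Y) \sum_(z : n.-tuple Z) \sum_(e : n.-tuple E)
  \sum_(t : (rounds Pi).-tuple 'I_(msize Pi))
    `| @out_prob n k l Pi P PE u v xh yh z e t - @ideal_prob n l P PE _ _ Q u v xh yh z e t |.

Definition merges_within n k l (Pi : protocol n k l) (P : X -> Y -> Z -> R)
    (PE : E -> R) (eps : R) : Prop :=
  exists Q : (rounds Pi).-tuple 'I_(msize Pi) -> R, is_dist Q /\ @merge_err n k l Pi P PE Q <= eps.

Definition achievable (P : X -> Y -> Z -> R) (PE : E -> R) (rho : R) : Prop :=
  exists (k l : nat -> nat) (err : nat -> R) (Pi : forall n, protocol n (k n) (l n)),
    [/\ err n @[n --> \oo] --> (0 : R),
        ((k n)%:R - (l n)%:R) / n%:R @[n --> \oo] --> rho &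
        forall n, @merges_within n (k n) (l n) (Pi n) P PE (err n)].

End Defs.

(* Main.v *)
Require Import Defs.
From HB Require Import structures.
From mathcomp Require Import all_boot all_order all_algebra.
From mathcomp Require Import all_classical all_reals all_analysis.
From mathcomp Require Import ring lra.
Set Implicit Arguments.
Unset Strict Implicit.
Unset Printing Implicit Defensive.
Import Order.TTheory GRing.Theory Num.Theory.
Import numFieldNormedType.Exports.
Local Open Scope classical_set_scope.
Local Open Scope ring_scope.

(** Converse. A transcript is compatible with a combinatorial rectangle of
    (Alice's view, Bob's view).  Compare the real run with one in which (X, Z)
    and Y are drawn independently and the two key copies are independent: on
    typical inputs the likelihood ratio is at most 2^(k + n I(XZ:Y)).  In the
    decoupled run the two sides stay independent given the transcript, so the
    event "the keys agree and Bob's pair is jointly typical with Z" has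
    probability about 2^-(l + n I(XY:Z)), once (key, Z, transcript) is known to
    be close to ideal.  Hence k - l >= n (I(XY:Z) - I(XZ:Y)) - o(n), with no
    restriction on the growth of k and l.

    Achievability. Alice sends a random-binning index of X^n, one-time padded
    with about n H(X|Y) key bits, and Bob decodes.  Since Z is independent of
    (X, Y) given the common label I, Bob may forget (X^n, Y^n) except for I^n and
    redraw a pair from its law given I^n; then a random hash of the forgotten
    X^n is a fresh key of about n H(X|I) = n H(X|Z) bits. *)

(** * Finite sums *)

(** The converse watches one cut: Alice together with the reference against Bob. Across it the
    correlation is k + n I(XZ:Y) at the start and l + n I(XY:Z) at the end. The two mutual
    informations differ by H(X|Y) - H(X|Z), because H(XYZ) cancels. An entropy argument would pay a
    continuity term of order error times (k + l), which need not be o(n) since only k - l is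
    controlled. The proof therefore compares the probabilities of a single test, where the error
    enters additively. Public messages correlate the two sides, so the law is studied at a fixed
    transcript.

    In the protocol Bob cannot simply hash the X^n that he outputs, because the ideal law requires
    the key to be independent of the merged pair; this is the obstacle that redrawing removes. The
    redrawn pair keeps the right joint law with Z^n because Z determines the label. Bins and hash
    are random only in the analysis: averaging fixes one good choice of each. *)

Lemma sum_pair (R : realType) (A B : finType) (F : A * B -> R) :
  \sum_p F p = \sum_a \sum_b F (a, b).
Proof. by rewrite pair_bigA; apply: eq_bigr => -[]. Qed.

Lemma sum_triple (R : realType) (X Y Z : finType) (P : X -> Y -> Z -> R) :
  \sum_(t : X * Y * Z) P t.1.1 t.1.2 t.2 = \sum_x \sum_y \sum_z P x y z.
Proof. by rewrite !pair_bigA. Qed.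

Lemma sum_unit_type (R : realType) (F : unit -> R) : \sum_u F u = F tt.
Proof. by rewrite (bigD1 tt)//= big1 ?addr0// => -[]. Qed.

Lemma ler_indic (R : realType) (b c : bool) : (b -> c) -> b%:R <= c%:R :> R.
Proof. by case: b => [->|] //; rewrite ler0n. Qed.

Lemma ler_sum_inj (R : realType) (I J : finType) (h : I -> J) (F : J -> R) :
  injective h -> (forall j, 0 <= F j) -> \sum_i F (h i) <= \sum_j F j.
Proof.
move=> hI F0; rewrite -(big_imset F (in2W hI)) /= [leRHS](bigID (mem (h @: I)))/=.
by rewrite lerDl sumr_ge0.
Qed.

Lemma sum_reorder (R : realType) (U V X Y Z E T : finType)
    (F : U -> V -> X -> Y -> Z -> E -> T -> R) :
  \sum_u \sum_v \sum_x \sum_y \sum_z \sum_e \sum_t F u v x y z e t =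
  \sum_z \sum_e \sum_(o : (U * (V * (X * Y))) * T)
    F o.1.1 o.1.2.1 o.1.2.2.1 o.1.2.2.2 z e o.2.
Proof.
pose G (o : U * (V * (X * Y))) z e t := F o.1 o.2.1 o.2.2.1 o.2.2.2 z e t.
transitivity (\sum_(o : U * (V * (X * Y))) \sum_z \sum_e \sum_t G o z e t).
  rewrite -(pair_bigA _ (fun u p => \sum_z \sum_e \sum_t G (u, p) z e t)) /=.
  apply: eq_bigr => u _.
  rewrite -(pair_bigA _ (fun v p => \sum_z \sum_e \sum_t G (u, (v, p)) z e t)) /=.
  apply: eq_bigr => v _.
  by rewrite -(pair_bigA _ (fun x y => \sum_z \sum_e \sum_t G (u, (v, (x, y))) z e t)).
rewrite exchange_big; apply: eq_bigr => z _.
rewrite exchange_big; apply: eq_bigr => e _.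
by rewrite pair_bigA.
Qed.

Lemma sum_push (R : realType) (W O : finType) (h : W -> O) (w : W -> R) (phi : O -> R) :
  \sum_o phi o * (\sum_i w i * (h i == o)%:R) = \sum_i w i * phi (h i).
Proof.
under eq_bigr do rewrite mulr_sumr.
rewrite exchange_big /=; apply: eq_bigr => i _.
rewrite (bigD1 (h i))//= eqxx big1 ?addr0 ?mulr1 1?mulrC// => o.
by rewrite eq_sym => /negbTE ->; rewrite !mulr0.
Qed.

(** Coupling inequality: both laws are images of the same weight, so only bad points contribute,
    each at most twice. *)
Lemma push_l1 (R : realType) (W O : finType) (h h' : W -> O) (wt : W -> R)
    (bad : pred W) :
  (forall w, 0 <= wt w) -> (forall w, ~~ bad w -> h w = h' w) ->
  \sum_o `|\sum_w wt w * (h w == o)%:R - \sum_w wt w * (h' w == o)%:R| <=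
  \sum_w wt w * (bad w)%:R * 2.
Proof.
move=> wt0 hh'.
apply: (@le_trans _ _ (\sum_o \sum_w wt w * (bad w)%:R *
   ((h w == o)%:R + (h' w == o)%:R))).
  apply: ler_sum => o _; rewrite -sumrB (le_trans (ler_norm_sum _ _ _))//.
  apply: ler_sum => w _; rewrite -mulrBr normrM ger0_norm// -mulrA ler_wpM2l//.
  have [_|/hh' ->] := boolP (bad w); last by rewrite subrr normr0 mul0r.
  by rewrite mul1r (le_trans (ler_normB _ _))// !ger0_norm.
rewrite exchange_big; apply: ler_sum => w _ /=.
rewrite -mulr_sumr ler_wpM2l ?mulr_ge0// big_split /=.
have s1 o' : \sum_(o : O) (o' == o)%:R = 1 :> R.
  by rewrite (bigD1 o')//= eqxx big1 ?addr0// => o; rewrite eq_sym => /negbTE ->.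
by rewrite !s1.
Qed.

Lemma sum_tuple_prod (R : realType) (T : finType) (n : nat) (h : 'I_n -> T -> R) :
  \sum_(t : n.-tuple T) \prod_(i < n) h i (tnth t i) =
  \prod_(i < n) \sum_(x : T) h i x.
Proof.
rewrite bigA_distr_bigA (reindex (@tuple_of_finfun T n)) /=.
  apply: eq_bigr => f _; apply: eq_bigr => i _; congr (h i _).
  by rewrite /tuple_of_finfun tnth_mktuple.
by exists (@finfun_of_tuple T n) => ? _; rewrite ?tuple_of_finfunK ?finfun_of_tupleK.
Qed.

Lemma sum2_tuple_prod (R : realType) (X Y : finType) (n : nat) (h : 'I_n -> X -> Y -> R) :
  \sum_(x : n.-tuple X) \sum_(y : n.-tuple Y) \prod_(i < n) h i (tnth x i) (tnth y i) =
  \prod_(i < n) \sum_x \sum_y h i x y.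
Proof.
rewrite -(sum_tuple_prod (fun i x => \sum_y h i x y)); apply: eq_bigr => x _.
exact: (sum_tuple_prod (fun i y => h i (tnth x i) y)).
Qed.

Lemma sum3_tuple_prod (R : realType) (X Y Z : finType) (n : nat)
    (h : 'I_n -> X -> Y -> Z -> R) :
  \sum_(x : n.-tuple X) \sum_(y : n.-tuple Y) \sum_(z : n.-tuple Z)
    \prod_(i < n) h i (tnth x i) (tnth y i) (tnth z i) =
  \prod_(i < n) \sum_x \sum_y \sum_z h i x y z.
Proof.
under eq_bigr => x _.
  under eq_bigr => y _ do
    rewrite (sum_tuple_prod (fun i z => h i (tnth x i) (tnth y i) z)).
  rewrite (sum_tuple_prod (fun i y => \sum_z h i (tnth x i) y z)).
  over.
exact: (sum_tuple_prod (fun i x => \sum_y \sum_z h i x y z)).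
Qed.

(** A random table with independent entries, entry [s] of law [q s]: all entries but one integrate
    to 1. It serves the random hash and Bob's table of redrawn pairs. *)
Lemma sum_ffun_at (R : realType) (S M : finType) (q : S -> M -> R)
    (phi : M -> R) (s0 : S) :
  (forall s, \sum_m q s m = 1) ->
  \sum_(f : {ffun S -> M}) (\prod_s q s (f s)) * phi (f s0) =
  \sum_m q s0 m * phi m.
Proof.
move=> q1.
under eq_bigr => f _.
  have -> : (\prod_s q s (f s)) * phi (f s0) =
      \prod_s (q s (f s) * if s == s0 then phi (f s) else 1).
    by rewrite big_split/= -big_mkcond /= big_pred1_eq.
  over.
rewrite -(bigA_distr_bigA (fun s m => q s m * if s == s0 then phi m else 1)).
rewrite (bigD1 s0)//= [X in _ * X]big1 ?mulr1; first by apply: eq_bigr => m _; rewrite ?eqxx.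
by move=> s /negbTE ->; under eq_bigr do rewrite mulr1.
Qed.

Lemma sum_ffun_at2 (R : realType) (S M : finType) (q : S -> M -> R)
    (phi psi : M -> R) (s0 s1 : S) :
  (forall s, \sum_m q s m = 1) -> s0 != s1 ->
  \sum_(f : {ffun S -> M}) (\prod_s q s (f s)) * (phi (f s0) * psi (f s1)) =
  (\sum_m q s0 m * phi m) * (\sum_m q s1 m * psi m).
Proof.
move=> q1 s01.
under eq_bigr => f _.
  have -> : (\prod_s q s (f s)) * (phi (f s0) * psi (f s1)) =
      \prod_s (q s (f s) * ((if s == s0 then phi (f s) else 1) *
                            (if s == s1 then psi (f s) else 1))).
    by rewrite !big_split/= -!big_mkcond /= !big_pred1_eq.
  over.
rewrite -(bigA_distr_bigA (fun s m => q s m *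
  ((if s == s0 then phi m else 1) * (if s == s1 then psi m else 1)))).
rewrite (bigD1 s0)//= (bigD1 s1) 1?eq_sym//= [X in _ * (_ * X)]big1 ?mulr1.
  have s10 : (s1 == s0) = false by rewrite eq_sym (negbTE s01).
  by congr (_ * _); apply: eq_bigr => m _; rewrite !eqxx ?s10 ?(negbTE s01) ?mulr1 ?mul1r.
move=> s /andP[/negbTE -> /negbTE ->].
by under eq_bigr do rewrite !mulr1.
Qed.

(** * Typicality *)

(** The variance of an i.i.d. sum: after expanding the square, each cross term has a factor that
    averages to 0. *)
Lemma sum_Pn_sqr (R : realType) (X Y Z : finType) (P c : X -> Y -> Z -> R) (n : nat) :
  \sum_x \sum_y \sum_z P x y z = 1 ->
  \sum_x \sum_y \sum_z P x y z * c x y z = 0 ->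
  \sum_(x : n.-tuple X) \sum_(y : n.-tuple Y) \sum_(z : n.-tuple Z)
    Pn P x y z * (\sum_(i < n) c (tnth x i) (tnth y i) (tnth z i)) ^+ 2 =
  n%:R * \sum_x \sum_y \sum_z P x y z * c x y z ^+ 2.
Proof.
move=> P1 c0.
(* [d i] puts [c] at coordinate [i] and 1 elsewhere, so each term of the expanded square becomes a
   product over coordinates. *)
pose d (i j : 'I_n) x y z : R := if j == i then c x y z else 1.
transitivity (\sum_(i < n) \sum_(j < n) \sum_(x : n.-tuple X)
    \sum_(y : n.-tuple Y) \sum_(z : n.-tuple Z)
    \prod_(k < n) (P (tnth x k) (tnth y k) (tnth z k) *
      (d i k (tnth x k) (tnth y k) (tnth z k) *
       d j k (tnth x k) (tnth y k) (tnth z k)))).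
  under [RHS]eq_bigr do rewrite exchange_big /=.
  rewrite [RHS]exchange_big /=; apply: eq_bigr => x _.
  under [RHS]eq_bigr do rewrite exchange_big /=.
  rewrite [RHS]exchange_big /=; apply: eq_bigr => y _.
  under [RHS]eq_bigr do rewrite exchange_big /=.
  rewrite [RHS]exchange_big /=; apply: eq_bigr => z _.
  rewrite expr2 big_distrlr /= mulr_sumr; apply: eq_bigr => i _.
  rewrite mulr_sumr; apply: eq_bigr => j _.
  rewrite !big_split /= /Pn /d -!big_mkcond /=.
  by rewrite !big_pred1_eq.
under eq_bigr => i _.
  under eq_bigr => j _.
    rewrite (sum3_tuple_prod
      (fun k x y z => P x y z * (d i k x y z * d j k x y z))).
    over.
  rewrite (bigD1 i) //= [X in _ + X]big1 ?addr0.
    rewrite (bigD1 i) //= [X in _ * X]big1 ?mulr1.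
      over.
    move=> k /negbTE ki; rewrite /d ki -[RHS]P1.
    by do 3 apply: eq_bigr => ? _; rewrite !mulr1.
  move=> j ji; rewrite (bigD1 i) //= [X in X * _](_ : _ = 0) ?mul0r//.
  rewrite -[RHS]c0; do 3 apply: eq_bigr => ? _.
  by rewrite /d eqxx eq_sym (negbTE ji) mulr1.
under eq_bigr => i _.
  under eq_bigr do under eq_bigr do under eq_bigr do rewrite /d eqxx -expr2.
  over.
by rewrite sumr_const card_ord mulr_natl.
Qed.

Lemma Pn_ge0 (R : realType) (X Y Z : finType) (P : X -> Y -> Z -> R) (n : nat)
    (x : n.-tuple X) (y : n.-tuple Y) (z : n.-tuple Z) :
  (forall x y z, 0 <= P x y z) -> 0 <= Pn P x y z.
Proof. by move=> P0; apply: prodr_ge0. Qed.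

Lemma Pn_expR (R : realType) (X Y Z : finType) (P r : X -> Y -> Z -> R) (n : nat)
    (x : n.-tuple X) (y : n.-tuple Y) (z : n.-tuple Z) :
  (forall x y z, P x y z != 0 -> 0 < r x y z) -> Pn P x y z != 0 ->
  Pn r x y z = expR (\sum_(i < n) ln (r (tnth x i) (tnth y i) (tnth z i))).
Proof.
move=> r0 /prodf_neq0 Pxyz; rewrite expR_sum; apply: eq_bigr => i _.
by rewrite lnK// posrE r0// Pxyz.
Qed.

(** With [r := P] and [q] a product of marginals this is a mutual information; with a joint and a
    single marginal it is a negated conditional entropy. Units are nats; base 2 returns through
    factors [ln 2]. One Chebyshev bound thus covers all typicality arguments. *)
Definition llr_mean (R : realType) (X Y Z : finType) (P r q : X -> Y -> Z -> R) : R :=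
  \sum_x \sum_y \sum_z P x y z * (ln (r x y z) - ln (q x y z)).

Definition llr_var (R : realType) (X Y Z : finType) (P r q : X -> Y -> Z -> R) : R :=
  \sum_x \sum_y \sum_z
    P x y z * (ln (r x y z) - ln (q x y z) - llr_mean P r q) ^+ 2.

(* Chebyshev's inequality for the log-likelihood ratio of [r] and [q]. *)
Lemma llr_concentration (R : realType) (X Y Z : finType) (P r q : X -> Y -> Z -> R)
    (n : nat) (a : R) :
  (forall x y z, 0 <= P x y z) -> \sum_x \sum_y \sum_z P x y z = 1 ->
  (forall x y z, P x y z != 0 -> 0 < r x y z) ->
  (forall x y z, P x y z != 0 -> 0 < q x y z) -> 0 < a ->
  \sum_(x : n.-tuple X) \sum_(y : n.-tuple Y) \sum_(z : n.-tuple Z)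
    Pn P x y z *
    (~~ ((expR (n%:R * llr_mean P r q - a) * Pn q x y z <= Pn r x y z) &&
         (Pn r x y z <= expR (n%:R * llr_mean P r q + a) * Pn q x y z)))%:R
  <= n%:R * llr_var P r q / a ^+ 2.
Proof.
move=> P0 P1 r0 q0 a0; rewrite /llr_var; set D := llr_mean P r q.
pose c x y z := ln (r x y z) - ln (q x y z) - D.
rewrite -(sum_Pn_sqr (P := P) (c := c)) //; last first.
  rewrite /c; under eq_bigr do under eq_bigr do under eq_bigr do rewrite mulrBr.
  under eq_bigr do under eq_bigr do rewrite sumrB -mulr_suml.
  under eq_bigr do rewrite sumrB -mulr_suml.
  by rewrite sumrB -mulr_suml P1 mul1r subrr.
rewrite mulr_suml; apply: ler_sum => x _.
rewrite mulr_suml; apply: ler_sum => y _.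
rewrite mulr_suml; apply: ler_sum => z _.
have [->|Pxyz] := eqVneq (Pn P x y z) 0; first by rewrite !mul0r.
rewrite -mulrA ler_wpM2l ?Pn_ge0//.
rewrite (Pn_expR (P := P) (r := r))// (Pn_expR (P := P) (r := q))// -!expRD !ler_expR.
set lr := \sum_(i < n) ln (r _ _ _); set lq := \sum_(i < n) ln (q _ _ _).
have -> : \sum_(i < n) c (tnth x i) (tnth y i) (tnth z i) = lr - lq - n%:R * D.
  by rewrite /c !sumrB sumr_const card_ord mulr_natl.
have a2 : 0 < a ^+ 2 by rewrite exprn_gt0.
case: (boolP (_ && _)) => /= [_|]; first by rewrite divr_ge0 ?sqr_ge0.
rewrite negb_and -!ltNge ler_pdivlMr// mul1r => /orP[h|h]; nra.
Qed.

Section Tensor.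
Variables (R : realType) (X Y Z : finType) (P : X -> Y -> Z -> R) (n : nat).
Local Notation P_n := (@Pn R X Y Z n P).

Lemma sum_Pn : \sum_x \sum_y \sum_z P x y z = 1 ->
  \sum_x \sum_y \sum_z P_n x y z = 1.
Proof.
by move=> P1; rewrite /Pn (sum3_tuple_prod (fun=> P)) P1 big1.
Qed.

Lemma margXZ_Pn x z :
  margXZ P_n (x, z) = \prod_(i < n) margXZ P (tnth x i, tnth z i).
Proof. exact: (sum_tuple_prod (fun i y => P (tnth x i) y (tnth z i))). Qed.

Lemma margXY_Pn x y :
  margXY P_n (x, y) = \prod_(i < n) margXY P (tnth x i, tnth y i).
Proof. exact: (sum_tuple_prod (fun i z => P (tnth x i) (tnth y i) z)). Qed.

Lemma margY_Pn y : margY P_n y = \prod_(i < n) margY P (tnth y i).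
Proof.
rewrite /margY -(sum_tuple_prod (fun i x => \sum_z P x (tnth y i) z)).
by apply: eq_bigr => x _; apply: (sum_tuple_prod (fun i z => P (tnth x i) (tnth y i) z)).
Qed.

Lemma margZ_Pn z : margZ P_n z = \prod_(i < n) margZ P (tnth z i).
Proof.
rewrite /margZ -(sum_tuple_prod (fun i x => \sum_y P x y (tnth z i))).
by apply: eq_bigr => x _; apply: (sum_tuple_prod (fun i y => P (tnth x i) y (tnth z i))).
Qed.

End Tensor.

Section Marginals.
Variables (R : realType) (X Y Z : finType) (P : X -> Y -> Z -> R).
Hypothesis P0 : forall x y z, 0 <= P x y z.

Lemma marg_ge :
  [/\ forall x y z, P x y z <= margXZ P (x, z),
      forall x y z, P x y z <= margXY P (x, y),
      forall x y, margXY P (x, y) <= margY P y &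
      forall x z, margXZ P (x, z) <= margZ P z].
Proof.
rewrite /margXZ /margXY /margY /margZ /=; split.
- by move=> x y z; rewrite (bigD1 y)//= lerDl sumr_ge0.
- by move=> x y z; rewrite (bigD1 z)//= lerDl sumr_ge0.
- by move=> x y; rewrite (bigD1 x)//= lerDl sumr_ge0// => ? _; rewrite sumr_ge0.
- by move=> x z; rewrite (bigD1 x)//= lerDl sumr_ge0// => ? _; rewrite sumr_ge0.
Qed.

Lemma marg_gt0 x y z : P x y z != 0 ->
  [/\ 0 < P x y z, 0 < margXZ P (x, z), 0 < margXY P (x, y),
      0 < margY P y & 0 < margZ P z].
Proof.
move=> Pn0; have [h1 h2 h3 h4] := marg_ge.
have p0 : 0 < P x y z by rewrite lt_neqAle eq_sym Pn0 P0.
have xz := lt_le_trans p0 (h1 _ _ _); have xy := lt_le_trans p0 (h2 _ _ _).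
split=> //; [exact: lt_le_trans xy (h3 x y) | exact: lt_le_trans xz (h4 x z)].
Qed.

Lemma marg_ge0 :
  [/\ forall t, 0 <= margXZ P t, forall t, 0 <= margXY P t,
      forall y, 0 <= margY P y & forall z, 0 <= margZ P z].
Proof. by split=> t; rewrite sumr_ge0// => ? _; rewrite ?sumr_ge0. Qed.

End Marginals.

(** * Runs of a protocol *)

Lemma size_trans (M : Type) (next : nat -> seq M -> M) (r : nat) :
  size (trans next r) = r.
Proof. by elim: r => //= r IH; rewrite size_rcons IH. Qed.

(** The rectangle property. It is meant for [next'] the run of views (a, b'), [next''] that of (a',
    b) and [next] that of (a, b): when Alice speaks [next] agrees with [next'], when Bob speaks with
    [next''], and along the common transcript these two agree. *)
Lemma trans_cross (M : eqType) (next next' next'' : nat -> seq M -> M) (r : nat) :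
  (forall i s, next' i s = next'' i s -> next i s = next' i s) ->
  trans next' r = trans next'' r -> trans next r = trans next' r.
Proof.
move=> nE; elim: r => //= r IH /rcons_inj[e1 e2].
by rewrite (IH e1) nE// e2 -e1.
Qed.

Section Outcome.
Variables (R : realType) (X Y Z E : finType) (n k l : nat) (Pi : protocol R X Y n k l).

(** All that is drawn in an honest run except [z] and [e], on which no move depends; given [hidden],
    the run is deterministic. *)
Definition hidden : finType :=
  (n.-tuple X * n.-tuple Y * k.-tuple bool * RA Pi * RB Pi)%type.

Definition visible : finType :=
  ((l.-tuple bool * (l.-tuple bool * (n.-tuple X * n.-tuple Y))) *
   (rounds Pi).-tuple 'I_(msize Pi))%type.

(* Alice and Bob may be fed different keys here; an honest run has [ka = kb]. *)
Definition transcript2 (x : n.-tuple X) (y : n.-tuple Y) (ka kb : k.-tuple bool)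
    (ra : RA Pi) (rb : RB Pi) : (rounds Pi).-tuple 'I_(msize Pi) :=
  Tuple (introT eqP (size_trans
    (fun i s => if speaker Pi i then msgA i x ka ra s else msgB i y kb rb s)
    (rounds Pi))).

Definition outcome (w : hidden) : visible :=
  let t := transcript2 w.1.1.1.1 w.1.1.1.2 w.1.1.2 w.1.1.2 w.1.2 w.2 in
  ((outA w.1.1.1.1 w.1.1.2 w.1.2 t, outB w.1.1.1.2 w.1.1.2 w.2 t), t).

Definition run_weight (P : X -> Y -> Z -> R) (PE : E -> R)
    (z : n.-tuple Z) (e : n.-tuple E) (w : hidden) : R :=
  Pn P w.1.1.1.1 w.1.1.1.2 z * PEn PE e * (2 ^+ k)^-1 * pA w.1.2 * pB w.2.

Definition out_vis P PE z e (o : visible) : R :=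
  \sum_w run_weight P PE z e w * (outcome w == o)%:R.

Definition ideal_vis P PE (Q : (rounds Pi).-tuple 'I_(msize Pi) -> R)
    (z : n.-tuple Z) (e : n.-tuple E) (o : visible) : R :=
  ideal_prob P PE Q o.1.1 o.1.2.1 o.1.2.2.1 o.1.2.2.2 z e o.2.

Lemma sum_hidden (F : hidden -> R) :
  \sum_w F w = \sum_x \sum_y \sum_key \sum_ra \sum_rb F (x, y, key, ra, rb).
Proof. by rewrite !pair_bigA; apply: eq_bigr => -[[[[? ?] ?] ?] ?]. Qed.

(** For fixed [z] and [e] the error is an l1 distance between an image law and the ideal law, the
    form that testing and coupling need. *)
Lemma merge_err_vis P PE Q :
  @merge_err R X Y Z E n k l Pi P PE Q =
  \sum_z \sum_e \sum_o `|out_vis P PE z e o - ideal_vis P PE Q z e o|.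
Proof.
rewrite /merge_err sum_reorder.
apply: eq_bigr => z _; apply: eq_bigr => e _; apply: eq_bigr => o _.
congr `| _ - _ |; rewrite /out_vis sum_hidden /out_prob.
do 5 apply: eq_bigr => ? _.
by rewrite /run_weight /=; congr (_ * (nat_of_bool _)%:R).
Qed.

End Outcome.

Section IdealExpectation.
Variables (R : realType) (X Y Z E : finType) (n k l : nat) (Pi : protocol R X Y n k l).
Variables (P : X -> Y -> Z -> R) (PE : E -> R).
Hypothesis PE1 : \sum_e PE e = 1.

Lemma sum_PEn : \sum_(e : n.-tuple E) PEn PE e = 1.
Proof. by rewrite /PEn (sum_tuple_prod (fun=> PE)) PE1 big1. Qed.

Lemma ideal_expect (Q : (rounds Pi).-tuple 'I_(msize Pi) -> R) psi :
  \sum_z \sum_e \sum_o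
    ideal_vis P PE Q z e o * psi o.1.1 o.1.2.2.1 o.1.2.2.2 z o.2 =
  \sum_u \sum_x \sum_y \sum_z \sum_t
    (2 ^+ l)^-1 * Pn P x y z * Q t * psi u x y z t.
Proof.
rewrite -(sum_reorder (fun u v x y z e t =>
  ideal_prob P PE Q u v x y z e t * psi u x y z t)).
apply: eq_bigr => u _; rewrite exchange_big; apply: eq_bigr => x _.
rewrite exchange_big; apply: eq_bigr => y _.
rewrite exchange_big; apply: eq_bigr => z _.
rewrite (bigD1 u)//= [X in _ + X]big1 ?addr0 => [|v]; last first.
  move=> /negbTE uv; rewrite big1// => e _; rewrite big1// => t _.
  by rewrite /ideal_prob eq_sym uv mul0r mulr0 !mul0r.
rewrite exchange_big; apply: eq_bigr => t _ /=.
rewrite -[RHS]mulr1 -[X in _ = _ * X]sum_PEn mulr_sumr; apply: eq_bigr => e _.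
rewrite /ideal_prob eqxx /= mul1r. ring.
Qed.

End IdealExpectation.

(** * Converse *)

Section Rectangle.
Variables (R : realType) (A B T OA OB : finType).
Variables (Pa : A -> R) (Pb : B -> R) (f : T -> A -> bool) (g : T -> B -> bool).
Variables (oA : A -> T -> OA) (oB : B -> T -> OB).
Hypotheses (Pa0 : forall a, 0 <= Pa a) (Pb0 : forall b, 0 <= Pb b).

(* Joint law of (Alice's output, transcript) when the two sides start independent. *)
Definition decoupled (t : T) (o : OA) : R :=
  (\sum_a Pa a * (f t a && (oA a t == o))%:R) * \sum_b Pb b * (g t b)%:R.

Lemma decoupled_ge0 t o : 0 <= decoupled t o.
Proof. by rewrite mulr_ge0// sumr_ge0// => ? _; rewrite mulr_ge0 ?ler0n. Qed.

(** A pair of views lies in at most one rectangle, so the masses of the rectangles add up to at most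
    the total product mass. *)
Lemma decoupled_sum :
  (forall a b, \sum_t (f t a && g t b)%:R <= 1 :> R) ->
  \sum_a Pa a <= 1 -> \sum_b Pb b <= 1 ->
  \sum_t \sum_o decoupled t o <= 1.
Proof.
move=> fg1 a1 b1.
have -> : \sum_t \sum_o decoupled t o =
    \sum_a \sum_b Pa a * Pb b * \sum_t (f t a && g t b)%:R.
  transitivity (\sum_t \sum_a \sum_b Pa a * Pb b * (f t a && g t b)%:R); last first.
    rewrite exchange_big; apply: eq_bigr => a _; rewrite exchange_big.
    by apply: eq_bigr => b _; rewrite mulr_sumr.
  apply: eq_bigr => t _; rewrite -mulr_suml exchange_big /= big_distrl /=.
  apply: eq_bigr => a _.
  rewrite (bigD1 (oA a t))//= eqxx andbT big1 ?addr0 => [|o]; last first.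
    by rewrite eq_sym => /negbTE ->; rewrite andbF mulr0.
  rewrite mulr_sumr; apply: eq_bigr => b _.
  by rewrite mulrACA -natrM mulnb.
apply: (@le_trans _ _ (\sum_a \sum_b Pa a * Pb b)).
  apply: ler_sum => a _; apply: ler_sum => b _.
  by rewrite ler_piMr ?mulr_ge0.
under eq_bigr do rewrite -mulr_sumr.
rewrite -mulr_suml; apply: le_trans (_ : 1 * 1 <= _); last by rewrite mulr1.
by rewrite ler_pM// sumr_ge0.
Qed.

(** [C] pays for replacing the true joint weight by a product. Inside a rectangle the product weight
    factors, so for fixed [t] and Bob view, passing the test amounts to matching Alice's output
    under its law given [t]. The last clause of the event bounds that law by [kap * (I * Q)] over
    Bob's mass, and [m] bounds the match under [I]. Bob's mass then cancels and [Q] sums to at most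
    1. *)
Lemma rectangle_bound (W : A -> B -> R) (I : OA -> R) (Q : T -> R)
    (S : OA -> OB -> bool) (G : A -> B -> bool) (C kap m : R) :
  (forall o, 0 <= I o) -> (forall t, 0 <= Q t) -> \sum_t Q t <= 1 ->
  0 <= C -> 0 <= kap -> 0 <= m ->
  (forall ob, \sum_o I o * (S o ob)%:R <= m) ->
  (forall a b, G a b -> W a b <= C * (Pa a * Pb b)) ->
  \sum_a \sum_b \sum_t W a b * [&& G a b, f t a, g t b, S (oA a t) (oB b t) &
    decoupled t (oA a t) <= kap * (I (oA a t) * Q t)]%:R <= C * kap * m.
Proof.
move=> I0 Q0 Q1 C0 k0 m0 Sm GW.
apply: (@le_trans _ _ (\sum_t C * (\sum_b (Pb b * (g t b)%:R) *
   \sum_a Pa a * [&& f t a, S (oA a t) (oB b t) &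
    decoupled t (oA a t) <= kap * (I (oA a t) * Q t)]%:R))).
  under eq_bigr do rewrite exchange_big /=.
  rewrite exchange_big; apply: ler_sum => t _ /=.
  rewrite exchange_big /= mulr_sumr; apply: ler_sum => b _ /=.
  rewrite mulr_sumr mulr_sumr; apply: ler_sum => a _.
  have [Gab|] := boolP (G a b) => /=; last first.
    by rewrite mulr0 !mulr_ge0 ?ler0n ?sumr_ge0.
  case: (f t a) => /=; last by rewrite !mulr0.
  case: (g t b) => /=; last by rewrite !mulr0 mul0r mulr0.
  by rewrite mulr1 (mulrCA (Pb b)) !mulrA ler_wpM2r ?ler0n// -mulrA GW.
rewrite -mulr_sumr -mulrA ler_wpM2l//.
apply: (@le_trans _ _ (\sum_t kap * m * Q t)); last first.
  by rewrite -mulr_sumr ler_piMr// mulr_ge0.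
apply: ler_sum => t _.
(* Bob's mass in the rectangle of [t]. If it is zero, [t] contributes nothing; otherwise it can be
   divided out. *)
set beta := \sum_b Pb b * (g t b)%:R.
have beta0 : 0 <= beta by apply: sumr_ge0 => b _; rewrite mulr_ge0 ?ler0n.
have [b0|bn0] := eqVneq beta 0.
  rewrite big1 ?mulr_ge0// => b _.
  move: b0 => /eqP; rewrite psumr_eq0 => [|? _]; last by rewrite mulr_ge0 ?ler0n.
  by move=> /allP /(_ b); rewrite mem_index_enum => /(_ isT) /eqP ->; rewrite mul0r.
have {}beta0 : 0 < beta by rewrite lt_neqAle eq_sym bn0.
apply: (@le_trans _ _ (\sum_b Pb b * (g t b)%:R * (kap * m * Q t / beta))); last first.
  by rewrite -mulr_suml -/beta mulrCA mulfV// mulr1.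
apply: ler_sum => b _; rewrite ler_wpM2l ?mulr_ge0 ?ler0n//.
apply: (@le_trans _ _ (\sum_o (\sum_a Pa a * (f t a && (oA a t == o))%:R) *
   (S o (oB b t) && (decoupled t o <= kap * (I o * Q t)))%:R)).
  under [leRHS]eq_bigr do rewrite big_distrl /=.
  rewrite exchange_big /=; apply: ler_sum => a _.
  rewrite (bigD1 (oA a t))//= eqxx andbT -mulrA -natrM mulnb lerDl.
  by apply: sumr_ge0 => o _; rewrite !mulr_ge0 ?ler0n.
(* [decoupled t o] is Alice's mass times [beta], so the threshold turns into a bound on Alice's mass
   alone. *)
apply: (@le_trans _ _ (\sum_o (I o * (S o (oB b t))%:R) * (kap * Q t / beta))).
  apply: ler_sum => o _.
  case: (S o _) => /=; last by rewrite !mulr0 mul0r.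
  have [h|_] := boolP (decoupled t o <= _); last first.
    by rewrite mulr0 !mulr_ge0 ?invr_ge0 ?(ltW beta0).
  by rewrite !mulr1 !mulrA ler_pdivlMr// (le_trans h)// mulrCA mulrA.
rewrite -mulr_suml (le_trans (ler_wpM2r _ (Sm _))) ?mulr_ge0 ?invr_ge0 ?(ltW beta0)//.
by rewrite !mulrA (mulrC m).
Qed.

End Rectangle.

(** Reference laws for the cut with [Z] on Alice's side: [prod_XZ_Y] decouples the initial data,
    [prod_XY_Z] the final data, when Bob holds both X and Y. *)
Definition prod_XZ_Y (R : realType) (X Y Z : finType) (P : X -> Y -> Z -> R) x y z : R :=
  margXZ P (x, z) * margY P y.

Definition prod_XY_Z (R : realType) (X Y Z : finType) (P : X -> Y -> Z -> R) x y z : R :=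
  margXY P (x, y) * margZ P z.

(** * One-shot converse *)

Section Converse.
Variables (R : realType) (X Y Z E : finType) (n k l : nat) (Pi : protocol R X Y n k l).
Variables (P : X -> Y -> Z -> R) (PE : E -> R).
Variable Q : (rounds Pi).-tuple 'I_(msize Pi) -> R.
Hypotheses (P0 : forall x y z, 0 <= P x y z) (P1 : \sum_x \sum_y \sum_z P x y z = 1).
Hypothesis PE1 : \sum_e PE e = 1.
Hypothesis Qd : is_dist Q.

Let Pn0 : forall x y z, 0 <= @Pn R X Y Z n P x y z.
Proof. by move=> *; apply: Pn_ge0. Qed.

Let Pn1 := sum_Pn n P1.

(** The reference's [z] joins Alice's view, so that the pair (key, [z]) is determined by one side's
    view and the transcript. *)
Definition alice : finType := (n.-tuple X * n.-tuple Z * k.-tuple bool * RA Pi)%type.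
Definition bob : finType := (n.-tuple Y * k.-tuple bool * RB Pi)%type.
Let key_wt : R := (2 ^+ k)^-1.

Let tr (a : alice) (b : bob) := transcript2 a.1.1.1 b.1.1 a.1.2 b.1.2 a.2 b.2.
(** The two sides of the rectangle of [t]: views that yield [t] with some partner, possibly one
    holding a different key. *)
Let fA t a := [exists b, tr a b == t].
Let gB t b := [exists a, tr a b == t].

Let tr_cross t a b : fA t a -> gB t b -> tr a b = t.
Proof.
move=> /existsP[b' /eqP e1] /existsP[a' /eqP e2]; rewrite -e1; apply: val_inj => /=.
move: (e1); rewrite -{1}e2 => /(congr1 val) /= e.
apply: trans_cross e => i s; by case: (speaker Pi i).
Qed.

Let Pa (a : alice) : R := margXZ (@Pn R X Y Z n P) a.1.1 * key_wt * pA a.2.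
Let Pb (b : bob) : R := margY (@Pn R X Y Z n P) b.1.1 * key_wt * pB b.2.
(** The honest run has one factor [key_wt] and a key-equality test, while [Pa a * Pb b] has two
    factors and no test: this is the source of the factor [2 ^+ k]. *)
Let W (a : alice) (b : bob) : R :=
  Pn P a.1.1.1 b.1.1 a.1.1.2 * key_wt * pA a.2 * pB b.2 * (a.1.2 == b.1.2)%:R.

Let kw0 : 0 <= key_wt. Proof. by rewrite invr_ge0 exprn_ge0. Qed.
Let pA0 a : 0 <= pA (p := Pi) a. Proof. by have [] := pA_dist Pi. Qed.
Let pB0 b : 0 <= pB (p := Pi) b. Proof. by have [] := pB_dist Pi. Qed.

Let Pa0 a : 0 <= Pa a.
Proof. by rewrite !mulr_ge0//; have [->] := marg_ge0 Pn0. Qed.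
Let Pb0 b : 0 <= Pb b.
Proof. by rewrite !mulr_ge0//; have [_ _ ->] := marg_ge0 Pn0. Qed.

Let sum_key : \sum_(key : k.-tuple bool) key_wt = 1.
Proof.
rewrite sumr_const card_tuple card_bool -mulr_natl natrX /key_wt.
by rewrite mulfV// expf_neq0.
Qed.

Let sumPa : \sum_a Pa a = 1.
Proof.
rewrite /Pa -(pair_bigA _ (fun p ra => margXZ (@Pn R X Y Z n P) p.1 * key_wt * pA ra)) /=.
under eq_bigr do rewrite -mulr_sumr (pA_dist Pi).2 mulr1.
rewrite -(pair_bigA _ (fun p ra => margXZ (@Pn R X Y Z n P) p * key_wt)) /=.
under eq_bigr do rewrite -mulr_sumr sum_key mulr1.
rewrite -(pair_bigA _ (fun x z => margXZ (@Pn R X Y Z n P) (x, z))) /= -[RHS]Pn1.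
by apply: eq_bigr => x _; rewrite exchange_big.
Qed.

Let sumPb : \sum_b Pb b = 1.
Proof.
rewrite /Pb -(pair_bigA _ (fun p rb => margY (@Pn R X Y Z n P) p.1 * key_wt * pB rb)) /=.
under eq_bigr do rewrite -mulr_sumr (pB_dist Pi).2 mulr1.
rewrite -(pair_bigA _ (fun y ra => margY (@Pn R X Y Z n P) y * key_wt)) /=.
under eq_bigr do rewrite -mulr_sumr sum_key mulr1.
by rewrite -[RHS]Pn1 [RHS]exchange_big.
Qed.

Let outA' (a : alice) (t : (rounds Pi).-tuple 'I_(msize Pi)) :=
  (outA a.1.1.1 a.1.2 a.2 t, a.1.1.2).
Let outB' (b : bob) (t : (rounds Pi).-tuple 'I_(msize Pi)) :=
  outB b.1.1 b.1.2 b.2 t.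

Let Idl (o : l.-tuple bool * n.-tuple Z) : R := (2 ^+ l)^-1 * margZ (@Pn R X Y Z n P) o.2.

Local Notation q1 := (prod_XZ_Y P).
Local Notation q2 := (prod_XY_Z P).

Let dec := decoupled Pa Pb fA gB outA'.

(** Test the final output: the keys agree, Bob's pair is typical with [z], and a likelihood
    threshold [kap] holds. The left side bounds the probability of passing from below through the
    ideal law, the right side from above through the actual run and [rectangle_bound]. *)
Lemma converse_oneshot (a kap : R) : 0 < a -> 0 < kap ->
  1 - n%:R * llr_var P P q2 / a ^+ 2 - kap^-1 - merge_err P PE Q <=
  n%:R * llr_var P P q1 / a ^+ 2 +
  2 ^+ k * expR (n%:R * llr_mean P P q1 + a) * kap *
    ((2 ^+ l)^-1 * expR (a - n%:R * llr_mean P P q2)).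
Proof.
move=> a0 kap0.
set D1 := llr_mean P P q1; set D2 := llr_mean P P q2.
pose typ1 x y z := Pn P x y z <= expR (n%:R * D1 + a) *
  (margXZ (@Pn R X Y Z n P) (x, z) * margY (@Pn R X Y Z n P) y).
(* The nonzero clause matters: where [margXY] vanishes the inequality holds trivially and gives no
   bound on the mass of such [z]. *)
pose typ2 x y z := (Pn P x y z != 0) && (expR (n%:R * D2 - a) *
  (margXY (@Pn R X Y Z n P) (x, y) * margZ (@Pn R X Y Z n P) z) <= Pn P x y z).
pose cond u z t := dec t (u, z) <= kap * (Idl (u, z) * Q t).
pose psi u (x : n.-tuple X) (y : n.-tuple Y) (z : n.-tuple Z) t : R :=
  (typ2 x y z && cond u z t)%:R.
pose phi (z : n.-tuple Z) (o : visible Pi) : R :=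
  [&& o.1.1 == o.1.2.1, typ2 o.1.2.2.1 o.1.2.2.2 z & cond o.1.1 z o.2]%:R.
have Pnq1 x y z : Pn q1 x y z =
    margXZ (@Pn R X Y Z n P) (x, z) * margY (@Pn R X Y Z n P) y.
  by rewrite margXZ_Pn margY_Pn -big_split.
have Pnq2 x y z : Pn q2 x y z =
    margXY (@Pn R X Y Z n P) (x, y) * margZ (@Pn R X Y Z n P) z.
  by rewrite margXY_Pn margZ_Pn -big_split.
have r0 x y z : P x y z != 0 -> 0 < P x y z by move=> /(marg_gt0 P0)[].
have q10 x y z : P x y z != 0 -> 0 < q1 x y z.
  by move=> /(marg_gt0 P0)[_ ? _ ? _]; rewrite mulr_gt0.
have q20 x y z : P x y z != 0 -> 0 < q2 x y z.
  by move=> /(marg_gt0 P0)[_ _ ? _ ?]; rewrite mulr_gt0.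
have T1 : \sum_x \sum_y \sum_z Pn P x y z * (~~ typ1 x y z)%:R <=
    n%:R * llr_var P P q1 / a ^+ 2.
  apply: le_trans (llr_concentration n P0 P1 r0 q10 a0).
  apply: ler_sum => x _; apply: ler_sum => y _; apply: ler_sum => z _.
  rewrite ler_wpM2l// ler_indic// Pnq1 negb_and => h; apply/orP; right; exact: h.
have T2 : \sum_x \sum_y \sum_z Pn P x y z * (~~ typ2 x y z)%:R <=
    n%:R * llr_var P P q2 / a ^+ 2.
  apply: le_trans (llr_concentration n P0 P1 r0 q20 a0).
  apply: ler_sum => x _; apply: ler_sum => y _; apply: ler_sum => z _.
  have [->|Pxyz] := eqVneq (Pn P x y z) 0; first by rewrite !mul0r.
  rewrite ler_wpM2l// ler_indic// Pnq2 /typ2 Pxyz /= negb_and => h.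
  by apply/orP; left.
have Idl0 o : 0 <= Idl o.
  by rewrite mulr_ge0 ?invr_ge0 ?exprn_ge0//; have [_ _ _ ->] := marg_ge0 Pn0.
have [Q0 Q1] := Qd.
have fg1 a' b' : \sum_t (fA t a' && gB t b')%:R <= 1 :> R.
  rewrite (bigD1 (tr a' b'))//= [X in _ + X]big1 ?addr0 => [|t].
    by rewrite -[leRHS](mulr1n 1) ler_nat leq_b1.
  apply: contraNeq; rewrite -(mulr0n 1) eqr_nat eqb0 negbK => /andP[h1 h2].
  by rewrite (tr_cross h1 h2).
(* [phi] takes only the values 0 and 1, so its two expectations differ by at most the l1 error. *)
have expect_err : \sum_z \sum_e \sum_o phi z o * (ideal_vis P PE Q z e o - out_vis P PE z e o)
    <= merge_err P PE Q.
  rewrite merge_err_vis.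
  apply: ler_sum => z _; apply: ler_sum => e _; apply: ler_sum => o _.
  rewrite distrC (le_trans (ler_norm _))// normrM ler_piMl//.
  by rewrite ger0_norm ?ler0n// -[leRHS](mulr1n 1) ler_nat leq_b1.
have ideal_bound : 1 - n%:R * llr_var P P q2 / a ^+ 2 - kap^-1 <=
    \sum_z \sum_e \sum_o phi z o * ideal_vis P PE Q z e o.
  have -> : \sum_z \sum_e \sum_o phi z o * ideal_vis P PE Q z e o =
      \sum_u \sum_x \sum_y \sum_z \sum_t (2 ^+ l)^-1 * Pn P x y z * Q t * psi u x y z t.
    rewrite -(ideal_expect P PE1 Q psi).
    apply: eq_bigr => z _; apply: eq_bigr => e _; apply: eq_bigr => o _.
    rewrite /ideal_vis /ideal_prob /phi /psi mulrC.
    by case: (_ == _) => /=; rewrite ?mul0r ?mulr0 ?mul0r.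
  have keyU : \sum_(u : l.-tuple bool) (2 ^+ l)^-1 = 1 :> R.
    by rewrite sumr_const card_tuple card_bool -[LHS]mulr_natl natrX mulfV// expf_neq0.
  have S1 : \sum_(u : l.-tuple bool) \sum_(x : n.-tuple X) \sum_y \sum_z \sum_t
      (2 ^+ l)^-1 * Pn P x y z * Q t = 1.
        transitivity (\sum_(u : l.-tuple bool) (2 ^+ l)^-1 : R); last exact: keyU.
    apply: eq_bigr => u _.
    transitivity ((2 ^+ l)^-1 * \sum_(x : n.-tuple X) \sum_y \sum_z Pn P x y z); last by rewrite Pn1 mulr1.
    do 3 (rewrite mulr_sumr; apply: eq_bigr => ? _).
    by rewrite -mulr_sumr Q1 mulr1.
  have S2 : \sum_(u : l.-tuple bool) \sum_x \sum_y \sum_z \sum_t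
      (2 ^+ l)^-1 * Pn P x y z * Q t * (~~ typ2 x y z)%:R =
      \sum_x \sum_y \sum_z Pn P x y z * (~~ typ2 x y z)%:R.
    rewrite -[RHS]mul1r -[X in _ = X * _]keyU mulr_suml; apply: eq_bigr => u _.
    do 3 (rewrite mulr_sumr; apply: eq_bigr => ? _).
    by rewrite -mulr_suml -mulr_sumr Q1 mulr1 mulrA.
  (* Where the threshold fails, the ideal mass is below [dec / kap], and [dec] has total mass at
     most 1. *)
  have S3 : \sum_u \sum_x \sum_y \sum_z \sum_t
      (2 ^+ l)^-1 * Pn P x y z * Q t * (~~ cond u z t)%:R <= kap^-1.
    apply: (@le_trans _ _ (kap^-1 * \sum_t \sum_o dec t o)); last first.
      rewrite ler_piMr ?invr_ge0 ?(ltW kap0)//.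
      by apply: decoupled_sum => //; rewrite (sumPa, sumPb).
    rewrite [X in _ <= _ * X]exchange_big /= sum_pair.
    rewrite mulr_sumr; apply: ler_sum => u _.
    under eq_bigr do rewrite exchange_big /=.
    rewrite exchange_big mulr_sumr; apply: ler_sum => z _ /=.
    under eq_bigr do rewrite exchange_big /=.
    rewrite exchange_big mulr_sumr; apply: ler_sum => t _ /=.
    have -> : \sum_x \sum_y (2 ^+ l)^-1 * Pn P x y z * Q t * (~~ cond u z t)%:R =
        Idl (u, z) * Q t * (~~ cond u z t)%:R.
      rewrite /Idl /margZ /= mulr_sumr !mulr_suml; apply: eq_bigr => x _.
      by rewrite mulr_sumr !mulr_suml.
    have [_|] := boolP (cond u z t) => /=.
      by rewrite mulr0 mulr_ge0 ?invr_ge0 ?(ltW kap0) ?decoupled_ge0.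
    by rewrite -ltNge mulr1 ler_pdivlMl// => /ltW.
  apply: (@le_trans _ _ (1 - \sum_x \sum_y \sum_z Pn P x y z * (~~ typ2 x y z)%:R -
      \sum_u \sum_x \sum_y \sum_z \sum_t
      (2 ^+ l)^-1 * Pn P x y z * Q t * (~~ cond u z t)%:R)).
    by rewrite !lerB.
  rewrite -{1}S1 -S2 -!sumrB; apply: ler_sum => u _; rewrite -!sumrB.
  do 3 (apply: ler_sum => ? _; rewrite -!sumrB).
  apply: ler_sum => t _; rewrite -{1}[_ * Q t]mulr1 -!mulrBr ler_wpM2l//.
    by rewrite !mulr_ge0 ?invr_ge0 ?exprn_ge0.
  by rewrite /psi; case: (typ2 _ _ _); case: (cond _ _ _) => /=; lra.
have out_bound  : \sum_z \sum_e \sum_o phi z o * out_vis P PE z e o <=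
  n%:R * llr_var P P q1 / a ^+ 2 + 2 ^+ k * expR (n%:R * D1 + a) * kap *
    ((2 ^+ l)^-1 * expR (a - n%:R * D2)).
  pose G (a' : alice) (b' : bob) := typ1 a'.1.1.1 b'.1.1 a'.1.1.2.
  pose wt z (w : hidden Pi) : R :=
    Pn P w.1.1.1.1 w.1.1.1.2 z * key_wt * pA w.1.2 * pB w.2.
  have -> : \sum_z \sum_e \sum_o phi z o * out_vis P PE z e o =
      \sum_z \sum_w wt z w * phi z (outcome w).
    apply: eq_bigr => z _.
    under eq_bigr do rewrite sum_push.
    rewrite exchange_big; apply: eq_bigr => w _; rewrite /= -mulr_suml; congr (_ * _).
    transitivity (\sum_(e : n.-tuple E) PEn PE e * wt z w).
      by apply: eq_bigr => e _; rewrite /run_weight /wt /key_wt; ring.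
    by rewrite -mulr_suml (sum_PEn n PE1) mul1r.
  have wt0 z w : 0 <= wt z w by rewrite !mulr_ge0.
  (* Atypical inputs are charged separately; on the others the change of measure is available. *)
  apply: (@le_trans _ _ (\sum_z \sum_w wt z w * (~~ typ1 w.1.1.1.1 w.1.1.1.2 z)%:R +
     \sum_z \sum_w wt z w *
       ((typ1 w.1.1.1.1 w.1.1.1.2 z)%:R * phi z (outcome w)))).
    rewrite -big_split /=; apply: ler_sum => z _.
    rewrite -big_split /=; apply: ler_sum => w _.
    rewrite -mulrDr ler_wpM2l//; case: (typ1 _ _ _) => /=.
      by rewrite mul1r add0r.
    by rewrite mul0r addr0 -[leRHS](mulr1n 1) ler_nat leq_b1.
  apply: lerD.
    apply: le_trans T1.
    under eq_bigr do rewrite sum_hidden /=.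
    rewrite exchange_big /=; apply: ler_sum => x _.
    rewrite exchange_big /=; apply: ler_sum => y _; apply: ler_sum => z _.
    rewrite /wt /=; under eq_bigr do under eq_bigr do rewrite -mulr_suml -mulr_sumr (pB_dist Pi).2 mulr1.
    under eq_bigr do rewrite -mulr_suml -mulr_sumr (pA_dist Pi).2 mulr1.
    by rewrite -mulr_suml -mulr_sumr sum_key mulr1.
  pose S (o : l.-tuple bool * n.-tuple Z) (ob : l.-tuple bool * (n.-tuple X * n.-tuple Y)) :=
    (o.1 == ob.1) && typ2 ob.2.1 ob.2.2 o.2.
  apply: (@le_trans _ _ (\sum_a \sum_b \sum_t W a b * [&& G a b, fA t a, gB t b,
      S (outA' a t) (outB' b t) & dec t (outA' a t) <= kap * (Idl (outA' a t) * Q t)]%:R)).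
    rewrite [leLHS]pair_bigA [leRHS]pair_bigA /=.
    (* Runs embed injectively into pairs of views with equal keys; in the sum over [t] only the
       actual transcript is kept. *)
    pose h (i : n.-tuple Z * hidden Pi) : alice * bob :=
      ((i.2.1.1.1.1, i.1, i.2.1.1.2, i.2.1.2), (i.2.1.1.1.2, i.2.1.1.2, i.2.2)).
    have hI : injective h.
      by move=> [z [[[[x y] key] ra] rb]] [z' [[[[x' y'] key'] ra'] rb']] [] *; subst.
    pose F (j : alice * bob) : R := \sum_t W j.1 j.2 * [&& G j.1 j.2, fA t j.1, gB t j.2,
      S (outA' j.1 t) (outB' j.2 t) &
      dec t (outA' j.1 t) <= kap * (Idl (outA' j.1 t) * Q t)]%:R.
    have W0 a' b' : 0 <= W a' b' by rewrite !mulr_ge0.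
        apply: le_trans (ler_sum_inj (F := F) hI _); last first.
      by move=> j; apply: sumr_ge0 => t _; rewrite mulr_ge0.
    apply: ler_sum => -[z w] _; rewrite /F /=.
    set a' := (_, w.1.2); set b' := (_, w.2).
    rewrite (bigD1 (tr a' b'))//= ler_wpDr//.
      by apply: sumr_ge0 => t _; rewrite mulr_ge0.
    have -> : fA (tr a' b') a' by apply/existsP; exists b'.
    have -> : gB (tr a' b') b' by apply/existsP; exists a'.
    by rewrite /W /= eqxx mulr1 /wt ler_wpM2l ?mulr_ge0// -natrM mulnb /S /= -andbA.
  apply: rectangle_bound => //.
  - by rewrite Q1.
  - exact: ltW.
  (* Bob's output fixes the key value, of ideal weight [2^-l]. Each [z] typical with his pair has
     [margZ] at most [expR (a - n * D2)] times its conditional probability, and these probabilities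
     sum to 1. *)
  - move=> [v [xh yh]]; rewrite /S /=.
    rewrite sum_pair /=.
    rewrite (bigD1 v)//= [X in _ + X]big1 ?addr0; last first.
      by move=> u /negbTE ->; rewrite big1// => z _; rewrite mulr0.
    rewrite eqxx /Idl /=; under eq_bigr do rewrite -mulrA.
    rewrite -mulr_sumr ler_wpM2l ?invr_ge0 ?exprn_ge0//.
    have [_ xy0 _ _] := marg_ge0 Pn0.
    have [h|h] := eqVneq (margXY (@Pn R X Y Z n P) (xh, yh)) 0.
      rewrite big1 ?expR_ge0// => z _; rewrite /typ2.
      have -> : Pn P xh yh z = 0.
        apply/eqP; rewrite eq_le Pn0 andbT -h; have [_ + _ _] := marg_ge Pn0; exact.
      by rewrite eqxx mulr0.
    have {}xy0 : 0 < margXY (@Pn R X Y Z n P) (xh, yh) by rewrite lt_neqAle eq_sym h xy0.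
    apply: (@le_trans _ _ (\sum_z expR (a - n%:R * D2) *
        (Pn P xh yh z / margXY (@Pn R X Y Z n P) (xh, yh)))).
      apply: ler_sum => z _; rewrite /typ2.
      case: (_ != 0) => /=; last by rewrite mulr0 mulr_ge0 ?expR_ge0 ?divr_ge0 ?(ltW xy0).
      have [hz|_] := boolP (_ * (_ * margZ _ z) <= _); last first.
        by rewrite mulr0 mulr_ge0 ?expR_ge0 ?divr_ge0 ?(ltW xy0).
      rewrite mulr1 mulrA ler_pdivlMr// -[leRHS]mulrC -ler_pdivrMr ?expR_gt0//.
      by rewrite -expRN opprB mulrC (mulrC (margZ _ _)).
    rewrite -mulr_sumr -mulr_suml -[X in X / _]/(margXY (@Pn R X Y Z n P) (xh, yh)).
    by rewrite divff// mulr1.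
  move=> a' b'; rewrite /G /typ1 => h.
  apply: (@le_trans _ _ (Pn P a'.1.1.1 b'.1.1 a'.1.1.2 * key_wt * pA a'.2 * pB b'.2)).
    by rewrite /W ler_piMr ?mulr_ge0// -[leRHS](mulr1n 1) ler_nat leq_b1.
  rewrite /Pa /Pb; have k2 : 2 ^+ k * key_wt = 1 by rewrite /key_wt mulfV// expf_neq0.
  have -> : 2 ^+ k * expR (n%:R * D1 + a) * (margXZ (Pn P) a'.1.1 * key_wt * pA a'.2 *
      (margY (Pn P) b'.1.1 * key_wt * pB b'.2)) =
      2 ^+ k * key_wt * (expR (n%:R * D1 + a) * (margXZ (Pn P) a'.1.1 *
      margY (Pn P) b'.1.1) * key_wt * pA a'.2 * pB b'.2) by ring.
  rewrite k2 mul1r !ler_wpM2r//.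
apply: le_trans out_bound.
rewrite lerBlDr -lerBlDl; apply: le_trans expect_err.
under [leRHS]eq_bigr do under eq_bigr do under eq_bigr do rewrite mulrBr.
under [leRHS]eq_bigr do under eq_bigr do rewrite sumrB.
under [leRHS]eq_bigr do rewrite sumrB.
by rewrite sumrB lerB.
Qed.

End Converse.

(** * Achievability *)

Lemma exists_le_avg (R : realType) (I : finType) (w h : I -> R) (c : R) :
  (forall i, 0 <= w i) -> \sum_i w i = 1 -> \sum_i w i * h i <= c ->
  exists i, h i <= c.
Proof.
move=> w0 w1 whc; apply/not_existsP => hc.
have hc' i : 0 < h i - c by rewrite subr_gt0 ltNge; apply/negP/hc.
have : \sum_i w i * (h i - c) <= 0.
  by under eq_bigr do rewrite mulrBr; rewrite sumrB -mulr_suml w1 mul1r subr_le0.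
rewrite le_eqVlt ltNge sumr_ge0 ?orbF => [|i _]; last by rewrite mulr_ge0// ltW.
rewrite psumr_eq0 => [|i _]; last by rewrite mulr_ge0// ltW.
move=> /allP wh; have := oner_neq0 R; rewrite -w1 big1 ?eqxx// => i _.
have := wh i; rewrite mem_index_enum => /(_ isT).
by rewrite mulf_eq0 (gt_eqF (hc' i)) orbF => /eqP.
Qed.

(** * Uniformly random functions *)

Section RandomFunction.
Variables (R : realType) (S M : finType).
Hypothesis M0 : (0 < #|M|)%N.

Let mu : R := #|M|%:R^-1.
Definition unif_wt (f : {ffun S -> M}) : R := \prod_(s : S) mu.

Let mu0 : 0 <= mu. Proof. by rewrite invr_ge0. Qed.

Lemma sum_unif : \sum_(m : M) mu = 1.
Proof.
by rewrite sumr_const -[LHS]mulr_natl mulfV// pnatr_eq0 -lt0n.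
Qed.

Lemma unif_wt_ge0 f : 0 <= unif_wt f.
Proof. exact: prodr_ge0. Qed.

Lemma unif_wt_sum : \sum_f unif_wt f = 1.
Proof.
rewrite /unif_wt -(bigA_distr_bigA (fun (s : S) (m : M) => mu)) big1// => s _.
exact: sum_unif.
Qed.

Lemma unif_collision s s' : s != s' -> \sum_f unif_wt f * (f s == f s')%:R = mu.
Proof.
move=> ss'.
transitivity (\sum_(m : M) \sum_f unif_wt f * ((f s == m)%:R * (f s' == m)%:R)).
  rewrite exchange_big; apply: eq_bigr => f _ /=.
  rewrite -mulr_sumr; congr (_ * _).
  rewrite (bigD1 (f s'))//= eqxx mulr1 [X in _ + X]big1 ?addr0// => m.
  by rewrite eq_sym => /negbTE ->; rewrite mulr0.
under eq_bigr => m _.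
  rewrite (sum_ffun_at2 (fun m' => (m' == m)%:R) (fun m' => (m' == m)%:R)
    (fun=> sum_unif) ss').
  have -> : \sum_m0 mu * (m0 == m)%:R = mu.
    by rewrite (bigD1 m)//= eqxx mulr1 big1 ?addr0// => m' /negbTE ->; rewrite mulr0.
  over.
by rewrite -mulr_sumr sum_unif mulr1.
Qed.

(** Off-diagonal terms vanish: the values at two distinct points are independent and [c] is
    centred. *)
Lemma unif_variance (v : S -> R) (c : M -> R) : \sum_m mu * c m = 0 ->
  \sum_f unif_wt f * (\sum_s v s * c (f s)) ^+ 2 =
  (\sum_s v s ^+ 2) * \sum_m mu * c m ^+ 2.
Proof.
move=> c0.
transitivity (\sum_s \sum_s' v s * v s' * \sum_f unif_wt f * (c (f s) * c (f s'))).
  under [RHS]eq_bigr => s _.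
    under eq_bigr do rewrite mulr_sumr.
    rewrite exchange_big /=; over.
  rewrite [RHS]exchange_big; apply: eq_bigr => f _ /=.
  rewrite expr2 big_distrlr mulr_sumr; apply: eq_bigr => s _ /=.
  by rewrite mulr_sumr; apply: eq_bigr => s' _; ring.
rewrite mulr_suml; apply: eq_bigr => s _.
rewrite (bigD1 s)//= [X in _ + X]big1 ?addr0 => [|s' s's]; last first.
  by rewrite (sum_ffun_at2 c c (fun=> sum_unif)) 1?eq_sym// c0 mul0r mulr0.
by rewrite -expr2 (sum_ffun_at (fun m => c m * c m) s (fun=> sum_unif)).
Qed.

(* Random binning: decode to the unique [x] in the bin that is typical with [y]. *)
Lemma random_binning (Y : finType) (p : S -> Y -> R) (T : S -> Y -> bool) (L : R) (x0 : S) :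
  (forall x y, 0 <= p x y) -> \sum_x \sum_y p x y <= 1 ->
  (forall y, \sum_x (T x y)%:R <= L) -> 0 <= L ->
  exists (F : S -> M) (dec : M -> Y -> S),
    \sum_x \sum_y p x y * (dec (F x) y != x)%:R <=
    \sum_x \sum_y p x y * (~~ T x y)%:R + L / #|M|%:R.
Proof.
move=> p0 p1 TL L0.
pose dec (F : {ffun S -> M}) c y := odflt x0 [pick x | T x y && (F x == c)].
(* Decoding fails only if the true [x] is atypical or another typical [x'] shares its bin; the last
   sum is the union bound over such [x']. *)
pose h (F : {ffun S -> M}) := \sum_x \sum_y p x y * (~~ T x y)%:R +
  \sum_x \sum_y p x y * \sum_(x' | x' != x) (T x' y)%:R * (F x' == F x)%:R.
have [F hF] : exists F, h F <= \sum_x \sum_y p x y * (~~ T x y)%:R + L / #|M|%:R.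
  apply: (exists_le_avg unif_wt_ge0 unif_wt_sum).
  rewrite /h; under eq_bigr do rewrite mulrDr.
  rewrite big_split /= -mulr_suml unif_wt_sum mul1r lerD2l.
  have -> : \sum_F unif_wt F * \sum_x \sum_y p x y *
        \sum_(x' | x' != x) (T x' y)%:R * (F x' == F x)%:R =
      \sum_x \sum_y p x y * \sum_(x' | x' != x) (T x' y)%:R * mu.
    under eq_bigr do rewrite mulr_sumr.
    rewrite exchange_big; apply: eq_bigr => x _.
    under eq_bigr do rewrite mulr_sumr.
    rewrite exchange_big; apply: eq_bigr => y _ /=.
    under eq_bigr do rewrite mulrCA mulr_sumr.
    rewrite -mulr_sumr exchange_big; congr (_ * _); apply: eq_bigr => x' x'x /=.
    by under eq_bigr do rewrite mulrCA; rewrite -mulr_sumr unif_collision.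
  apply: (@le_trans _ _ (\sum_x \sum_y p x y * (L * mu))).
    apply: ler_sum => x _; apply: ler_sum => y _; rewrite ler_wpM2l//.
    rewrite -mulr_suml ler_wpM2r// (le_trans _ (TL y))//.
    by rewrite [leRHS](bigD1 x)//= lerDr.
  under eq_bigr do rewrite -mulr_suml.
  by rewrite -mulr_suml ler_piMl// mulr_ge0.
exists F, (dec F); apply: le_trans hF.
rewrite /h -big_split; apply: ler_sum => x _ /=.
rewrite -big_split; apply: ler_sum => y _ /=.
rewrite -mulrDr ler_wpM2l//.
have [Txy|_] := boolP (T x y); last first.
  apply: (@le_trans _ _ 1); first by rewrite -[leRHS](mulr1n 1) ler_nat leq_b1.
  by rewrite lerDl sumr_ge0// => x' _; rewrite mulr_ge0.
rewrite add0r /dec; case: pickP => [x' /andP[Tx' Fx']|] /=; last first.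
  by move=> /(_ x); rewrite Txy eqxx.
have [_|x'x] := eqVneq x' x; first by rewrite sumr_ge0// => ? _; rewrite mulr_ge0.
by rewrite (bigD1 x')//= Tx' Fx' mulr1 lerDl sumr_ge0// => ? _; rewrite mulr_ge0.
Qed.

(* Leftover hashing; [kap] is the free parameter of [2 |a| <= kap a^2 + 1 / kap]. *)
Lemma random_hash (I : finType) (w : I -> R) (p : I -> S -> R) (T : I -> S -> bool)
    (d kap : R) :
  (forall i, 0 <= w i) -> \sum_i w i <= 1 ->
  (forall i x, 0 <= p i x) -> (forall i, \sum_x p i x = 1) ->
  (forall i x, T i x -> p i x <= d) -> 0 < kap -> 0 <= d ->
  exists G : S -> M,
    \sum_i w i * \sum_u `|\sum_x p i x * (G x == u)%:R - #|M|%:R^-1| <=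
    2 * \sum_i w i * \sum_x p i x * (~~ T i x)%:R +
    (kap * d + #|M|%:R / kap) / 2.
Proof.
move=> w0 w1 p0 p1 Td k0 d0.
(* Centred indicator of the hash value [u]: the deviation from uniform is the [p i]-average of
   [c u (G x)]. *)
pose c u (m : M) : R := (m == u)%:R - mu.
have cE u : \sum_m mu * c u m = 0.
  rewrite /c; under eq_bigr do rewrite mulrBr.
  rewrite sumrB -!mulr_sumr sum_unif mulr1 (bigD1 u)//= eqxx big1 ?addr0 ?mulr1 ?subrr//.
  by move=> m /negbTE ->.
have c2 u : \sum_m mu * c u m ^+ 2 <= mu.
  have -> : \sum_m mu * c u m ^+ 2 = \sum_m (mu * (m == u)%:R - mu * (mu * (m == u)%:R) - mu * (mu * c u m)).
    by apply: eq_bigr => m _; rewrite /c; case: (m == u) => /=; ring.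
  rewrite !sumrB -!mulr_sumr [mu * \sum_m c _ m]mulr_sumr cE mulr0 subr0.
  have -> : \sum_m (m == u)%:R = 1 :> R.
    by rewrite (bigD1 u)//= eqxx big1 ?addr0// => m /negbTE ->.
  by rewrite !mulr1 lerBlDr lerDl mulr_ge0.
(* Only these truncated weights enter the second moment, as they are at most [d]. The atypical
   remainder is bounded in l1, where [c] has norm at most 2. *)
pose v i x := p i x * (T i x)%:R.
pose h (G : {ffun S -> M}) := 2 * \sum_i w i * \sum_x p i x * (~~ T i x)%:R +
   \sum_i w i * \sum_u (kap * (\sum_x v i x * c u (G x)) ^+ 2 + kap^-1) / 2.
have [G hG] : exists G, h G <= 2 * \sum_i w i * \sum_x p i x * (~~ T i x)%:R +
    (kap * d + #|M|%:R / kap) / 2.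
  apply: (exists_le_avg unif_wt_ge0 unif_wt_sum).
  rewrite /h; under eq_bigr do rewrite mulrDr.
  rewrite big_split /= -mulr_suml unif_wt_sum mul1r lerD2l.
  have -> : \sum_G unif_wt G * \sum_i w i *
        \sum_u (kap * (\sum_x v i x * c u (G x)) ^+ 2 + kap^-1) / 2 =
      \sum_i w i * \sum_u (kap * ((\sum_x v i x ^+ 2) * \sum_m mu * c u m ^+ 2) + kap^-1) / 2.
    under eq_bigr do rewrite mulr_sumr.
    rewrite exchange_big; apply: eq_bigr => i _ /=.
    under eq_bigr do rewrite mulrCA mulr_sumr.
    rewrite -mulr_sumr exchange_big; congr (_ * _); apply: eq_bigr => u _ /=.
    under eq_bigr do rewrite mulrA mulrDr mulrCA.
    by rewrite -mulr_suml big_split /= -mulr_sumr unif_variance// -mulr_suml unif_wt_sum mul1r.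
  apply: (@le_trans _ _ (\sum_i w i * ((kap * d + #|M|%:R / kap) / 2))); last first.
    rewrite -mulr_suml ler_piMl// divr_ge0// addr_ge0// ?mulr_ge0 ?invr_ge0//; exact: ltW.
  apply: ler_sum => i _; rewrite ler_wpM2l// -mulr_suml ler_pM2r ?invr_gt0//.
  have v2 : \sum_x v i x ^+ 2 <= d.
    rewrite -[leRHS]mulr1 -(p1 i) mulr_sumr; apply: ler_sum => x _.
    rewrite expr2 /v; have [Tx|_] := boolP (T i x).
      by rewrite !mulr1 ler_wpM2r// Td.
    by rewrite !mulr0 mulr_ge0.
  apply: (@le_trans _ _ (\sum_(u : M) (kap * (d * mu) + kap^-1))).
    apply: ler_sum => u _; rewrite lerD2r ler_wpM2l ?(ltW k0)//.
    apply: ler_pM => //; apply: sumr_ge0 => ? _; first by rewrite sqr_ge0.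
    by apply: mulr_ge0 => //; rewrite sqr_ge0.
  rewrite big_split /= -!mulr_sumr sum_unif mulr1 lerD2l.
  by rewrite sumr_const mulr_natl.
exists G; apply: le_trans hG.
rewrite /h mulr_sumr -big_split; apply: ler_sum => i _ /=.
rewrite mulrCA -mulrDr ler_wpM2l//.
have mE u : \sum_x p i x * (G x == u)%:R - mu =
    \sum_x (p i x * (~~ T i x)%:R) * c u (G x) + \sum_x v i x * c u (G x).
  rewrite -big_split /= -[X in _ - X]mul1r -[X in _ - X * _](p1 i) mulr_suml -sumrB.
  apply: eq_bigr => x _; rewrite /v /c; case: (T i x) => /=; ring.
apply: (@le_trans _ _ (\sum_u ((\sum_x (p i x * (~~ T i x)%:R) * `|c u (G x)|) +
   (kap * (\sum_x v i x * c u (G x)) ^+ 2 + kap^-1) / 2))).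
  apply: ler_sum => u _; rewrite mE (le_trans (ler_normD _ _))// lerD//.
    rewrite (le_trans (ler_norm_sum _ _ _))// ler_sum// => x _.
    by rewrite normrM ger0_norm// mulr_ge0.
  set a := \sum_x _; rewrite ler_pdivlMr// -subr_ge0.
  have -> : kap * a ^+ 2 + kap^-1 - `|a| * 2 = kap * (`|a| - kap^-1) ^+ 2.
    by rewrite -[in LHS](real_normK (num_real a)); field; rewrite gt_eqF.
  by rewrite mulr_ge0 ?sqr_ge0 ?(ltW k0).
rewrite big_split /= lerD2r exchange_big mulr_sumr; apply: ler_sum => x _ /=.
rewrite -mulr_sumr mulrC ler_wpM2r ?mulr_ge0//.
apply: (@le_trans _ _ (\sum_u ((G x == u)%:R + mu))).
  apply: ler_sum => u _; rewrite (le_trans (ler_normB _ _))//.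
  by rewrite !ger0_norm.
rewrite big_split /= sum_unif (bigD1 (G x))//= eqxx big1 ?addr0//.
by move=> u; rewrite eq_sym => /negbTE ->.
Qed.

End RandomFunction.

(** * One-time pad and the merging protocol *)

Definition xor_tuple (k : nat) (a b : k.-tuple bool) : k.-tuple bool :=
  [tuple tnth a i (+) tnth b i | i < k].

Lemma xor_tupleK k (a b : k.-tuple bool) : xor_tuple (xor_tuple a b) b = a.
Proof. by apply: eq_from_tnth => i; rewrite !tnth_mktuple addbK. Qed.

Lemma xor_tupleC k (a b : k.-tuple bool) : xor_tuple a b = xor_tuple b a.
Proof. by apply: eq_from_tnth => i; rewrite !tnth_mktuple addbC. Qed.

Section MergeProtocol.
Variables (R : realType) (X Y Z E L : finType) (n k l : nat).
Variables (PT : L -> n.-tuple X * n.-tuple Y -> R).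
Hypothesis PTd : forall i, is_dist (PT i).
Variables (label : n.-tuple X -> n.-tuple Y -> L) (F : n.-tuple X -> k.-tuple bool).
Variables (dec : k.-tuple bool -> n.-tuple Y -> n.-tuple X).
Variable G : n.-tuple X -> l.-tuple bool.

Lemma unit_dist : is_dist (fun _ : unit => 1 : R).
Proof. by split=> //; rewrite sum_unit_type. Qed.

(** Private randomness is drawn before the label is known, so it is a whole table with one
    independent pair per label; Bob reads the entry at the decoded label. *)
Definition resample_wt (f : {ffun L -> n.-tuple X * n.-tuple Y}) : R :=
  \prod_i PT i (f i).

Lemma resample_dist : is_dist resample_wt.
Proof.
split=> [f|]; first by apply: prodr_ge0 => i _; have [] := PTd i.
rewrite /resample_wt -(bigA_distr_bigA PT) big1// => i _; by have [] := PTd i.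
Qed.

(* One-time-padded binning index; Bob forgets [(x, y)] down to the label and
   redraws a fresh pair, which frees [G x] to serve as key. *)
Definition merge_protocol : protocol R X Y n k l :=
  @Protocol R X Y n k l 1 #|{: k.-tuple bool}| unit _ unit_dist _ _ resample_dist
    (fun=> true)
    (fun _ x key _ _ => enum_rank (xor_tuple (F x) key))
    (fun _ _ key _ _ => enum_rank key)
    (fun x _ _ _ => G x)
    (fun y key rb s =>
       let x := dec (if s is m :: _ then xor_tuple (enum_val m) key else key) y in
       (G x, rb (label x y))).

Local Notation Pi := merge_protocol.

(** The run as it would end if decoding never failed, with the actual transcript. Its law has a
    closed form, and its distance to the real run is a decoding error. *)
Definition correct_outcome (w : hidden Pi) : visible Pi :=
  ((G w.1.1.1.1, (G w.1.1.1.1, w.2 (label w.1.1.1.1 w.1.1.1.2))), (outcome w).2).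

(** One-time pad: given [x], each message comes from exactly one of Alice's keys, so under a uniform
    key the transcript is uniform and independent of [x]. *)
Lemma merge_transcript x y ka kb (ra : RA Pi) (rb : RB Pi)
    (t : (rounds Pi).-tuple 'I_(msize Pi)) :
  (transcript2 x y ka kb ra rb == t) = (ka == xor_tuple (F x) (enum_val (thead t))).
Proof.
rewrite -val_eqE /=; case: t => [[|m [|? ?]]] //= st.
rewrite eqseq_cons eqxx andbT /thead (tnth_nth m) /= -(inj_eq enum_val_inj) enum_rankK.
apply/eqP/eqP => [<-|->].
  by rewrite xor_tupleC (xor_tupleC (F x)) xor_tupleK.
by rewrite xor_tupleC (xor_tupleC (F x)) xor_tupleK.
Qed.

Lemma outcome_correct (w : hidden Pi) :
  dec (F w.1.1.1.1) w.1.1.1.2 = w.1.1.1.1 -> outcome w = correct_outcome w.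
Proof.
case: w => [[[[x y] key] ra] rb] /= h.
by rewrite /correct_outcome /outcome /= enum_rankK xor_tupleK h.
Qed.

Variables (P : X -> Y -> Z -> R) (PE : E -> R).
Hypotheses (P0 : forall x y z, 0 <= P x y z).
Hypotheses (PE0 : forall e, 0 <= PE e) (PE1 : \sum_e PE e = 1).
Variables (p : L -> R) (PZ : L -> n.-tuple Z -> R).
Hypotheses (p0 : forall i, 0 <= p i) (PZd : forall i, is_dist (PZ i)).
Hypothesis Pdec : forall x y z, Pn P x y z = \sum_i p i * PT i (x, y) * PZ i z.
Hypothesis PTlabel : forall i x y, PT i (x, y) != 0 -> label x y = i.

Let Q (t : (rounds Pi).-tuple 'I_(msize Pi)) : R := (2 ^+ k)^-1.

Lemma unif_msg_dist : is_dist Q.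
Proof.
split=> [t|]; first by rewrite invr_ge0 exprn_ge0.
rewrite sumr_const card_tuple card_ord /= card_tuple card_bool expn1.
by rewrite -[LHS]mulr_natl natrX mulfV// expf_neq0.
Qed.

Let PEn0 e : 0 <= PEn (n := n) PE e. Proof. exact: prodr_ge0. Qed.

Let rw0 z e (w : hidden Pi) : 0 <= run_weight P PE z e w.
Proof.
have [A0 _] := pA_dist Pi; have [B0 _] := pB_dist Pi.
by rewrite !mulr_ge0 ?invr_ge0 ?exprn_ge0 ?Pn_ge0.
Qed.

Let PX i x : R := \sum_y PT i (x, y).

(** One key per transcript gives the uniform factor [Q]. The label equals the mixture index on the
    support, so given [i] the redrawn pair, [z] and the hashed [x] are independent, and [x] survives
    only in the last sum. *)
Lemma correct_lawE z e (o : visible Pi) :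
  \sum_(w : hidden Pi) run_weight P PE z e w * (correct_outcome w == o)%:R =
  PEn PE e * Q o.2 * (o.1.1 == o.1.2.1)%:R *
  \sum_i p i * PT i o.1.2.2 * PZ i z * \sum_x PX i x * (G x == o.1.1)%:R.
Proof.
rewrite sum_hidden; case: o => [[u [v xy]] t].
have keyE x c : \sum_key \sum_ra \sum_rb
     run_weight P PE z e (x, c, key, ra, rb) *
     (correct_outcome (x, c, key, ra, rb) == (u, (v, xy), t))%:R =
   PEn PE e * Q t * (u == v)%:R * (Pn P x c z * PT (label x c) xy * (G x == u)%:R).
  have -> : PEn PE e * Q t * (u == v)%:R * (Pn P x c z * PT (label x c) xy * (G x == u)%:R) =
    PEn PE e * Q t * Pn P x c z * ((u == v)%:R * (G x == u)%:R) *
    (\sum_rb resample_wt rb * (rb (label x c) == xy)%:R).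
    rewrite (sum_ffun_at (fun m => (m == xy)%:R)); last by move=> s; have [] := PTd s.
    rewrite (bigD1 xy)//= eqxx mulr1 big1 ?addr0; first by ring.
    by move=> m /negbTE ->; rewrite mulr0.
  rewrite (bigD1 (xor_tuple (F x) (enum_val (thead t))))//= [X in _ + X]big1 ?addr0.
    rewrite sum_unit_type mulr_sumr; apply: eq_bigr => rb _.
    rewrite /correct_outcome /outcome /= /run_weight /=.
    rewrite !xpair_eqE merge_transcript eqxx andbT /Q.
    have [->|Gu] := eqVneq (G x) u; last by rewrite /=; ring.
    rewrite /=; case: (u == v); rewrite /=; ring.
  move=> key kn; rewrite big1// => ra _; rewrite big1// => rb _.
  rewrite [_ == _](_ : _ = false) ?mulr0//; apply/negbTE.
  by apply: contraNneq kn => /(congr1 snd) /= /eqP; rewrite merge_transcript.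
under eq_bigr do under eq_bigr do rewrite keyE.
under eq_bigr do rewrite -mulr_sumr.
rewrite -mulr_sumr; congr (_ * _).
under [RHS]eq_bigr do rewrite mulr_sumr.
rewrite [RHS]exchange_big; apply: eq_bigr => x _ /=.
transitivity (\sum_y \sum_i p i * PT i xy * PZ i z * (PT i (x, y) * (G x == u)%:R)).
  apply: eq_bigr => y _; rewrite Pdec !mulr_suml; apply: eq_bigr => i _.
  have [->|h] := eqVneq (PT i (x, y)) 0; first by rewrite mulr0 !mul0r mulr0.
  by rewrite (PTlabel h); ring.
rewrite exchange_big; apply: eq_bigr => i _ /=.
by rewrite -mulr_sumr -mulr_suml.
Qed.

(** The first term is the coupling with [correct_outcome]. The second arises because that law and
    the ideal one differ only in the hash given the label; all other factors sum to 1. *)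
Lemma merge_protocol_err :
  merge_err (Pi := Pi) P PE Q <=
  2 * \sum_x \sum_y margXY (@Pn R X Y Z n P) (x, y) * (dec (F x) y != x)%:R +
  \sum_i p i * \sum_u `|\sum_x PX i x * (G x == u)%:R - (2 ^+ l)^-1|.
Proof.
pose out' z e (o : visible Pi) := \sum_(w : hidden Pi) run_weight P PE z e w * (correct_outcome w == o)%:R.
rewrite merge_err_vis.
apply: (@le_trans _ _ (\sum_z \sum_e \sum_o `|out_vis P PE z e o - out' z e o| +
  \sum_z \sum_e \sum_o `|out' z e o - ideal_vis P PE Q z e o|)).
  rewrite -big_split; apply: ler_sum => z _ /=; rewrite -big_split.
  apply: ler_sum => e _ /=; rewrite -big_split; apply: ler_sum => o _ /=.
  exact: ler_distD.
apply: lerD.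
  pose bad (w : hidden Pi) := dec (F w.1.1.1.1) w.1.1.1.2 != w.1.1.1.1.
  apply: (@le_trans _ _ (\sum_z \sum_e \sum_w run_weight P PE z e w * (bad w)%:R * 2)).
    apply: ler_sum => z _; apply: ler_sum => e _.
    by apply: push_l1 => // w; rewrite negbK => /eqP /outcome_correct.
  rewrite le_eqVlt; apply/orP; left; apply/eqP.
  under eq_bigr do under eq_bigr do rewrite -mulr_suml.
  under eq_bigr do rewrite -mulr_suml.
  rewrite -mulr_suml mulrC; congr (_ * _).
  under eq_bigr do under eq_bigr do rewrite sum_hidden.
  under eq_bigr do rewrite exchange_big /=.
  rewrite exchange_big; apply: eq_bigr => x _ /=.
  under eq_bigr do rewrite exchange_big /=.
  rewrite exchange_big; apply: eq_bigr => y _ /=.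
  rewrite /margXY /= mulr_suml; apply: eq_bigr => z _.
  transitivity (\sum_e PEn (n := n) PE e * (Pn P x y z * (dec (F x) y != x)%:R)); last first.
    by rewrite -mulr_suml (sum_PEn n PE1) mul1r.
  apply: eq_bigr => e _.
  transitivity (\sum_(key : k.-tuple bool) (2 ^+ k)^-1 * (PEn PE e *
      (Pn P x y z * (dec (F x) y != x)%:R))); last first.
    rewrite -mulr_suml sumr_const card_tuple card_bool.
    by rewrite -[X in X * _]mulr_natl natrX mulfV ?mul1r// expf_neq0.
  apply: eq_bigr => key _; rewrite sum_unit_type.
  transitivity (\sum_rb resample_wt rb * ((2 ^+ k)^-1 * (PEn PE e *
      (Pn P x y z * (dec (F x) y != x)%:R)))); last first.
    by rewrite -mulr_suml resample_dist.2 mul1r.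
  by apply: eq_bigr => rb _; rewrite /run_weight /bad /=; ring.
pose gap i u := `|\sum_x PX i x * (G x == u)%:R - (2 ^+ l)^-1|.
have PT0 i xy : 0 <= PT i xy by have [] := PTd i.
have PZ0 i z : 0 <= PZ i z by have [] := PZd i.
have Q0 t : 0 <= Q t by rewrite invr_ge0 exprn_ge0.
apply: (@le_trans _ _ (\sum_z \sum_e \sum_(o : visible Pi) PEn PE e * Q o.2 *
   (o.1.1 == o.1.2.1)%:R * \sum_i p i * PT i o.1.2.2 * PZ i z * gap i o.1.1)).
  apply: ler_sum => z _; apply: ler_sum => e _; apply: ler_sum => o _.
  rewrite /out' correct_lawE /ideal_vis /ideal_prob Pdec -surjective_pairing.
  have -> : (\sum_i p i * PT i o.1.2.2 * PZ i z) * PEn PE e * ((o.1.1 == o.1.2.1)%:R / 2 ^+ l) * Q o.2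
     = PEn PE e * Q o.2 * (o.1.1 == o.1.2.1)%:R *
       \sum_i p i * PT i o.1.2.2 * PZ i z * (2 ^+ l)^-1.
    by rewrite -mulr_suml; ring.
  rewrite -mulrBr -sumrB normrM ger0_norm ?mulr_ge0// ler_wpM2l ?mulr_ge0//.
  rewrite (le_trans (ler_norm_sum _ _ _))//; apply: ler_sum => i _.
  by rewrite -mulrBr normrM ger0_norm ?mulr_ge0.
rewrite le_eqVlt; apply/orP; left; apply/eqP.
transitivity (\sum_z \sum_(e : n.-tuple E) PEn PE e *
    \sum_i \sum_u p i * gap i u * PZ i z).
  apply: eq_bigr => z _; apply: eq_bigr => e _.
  rewrite sum_pair.
  transitivity (\sum_(o : l.-tuple bool * (l.-tuple bool * (n.-tuple X * n.-tuple Y)))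
     PEn PE e * ((o.1 == o.2.1)%:R * \sum_i p i * PT i o.2.2 * PZ i z * gap i o.1)).
    apply: eq_bigr => o _; rewrite /= -[RHS]mulr1 -[X in _ = _ * X](unif_msg_dist.2) mulr_sumr.
    by apply: eq_bigr => t _; ring.
  rewrite -mulr_sumr; congr (_ * _); rewrite sum_pair [RHS]exchange_big.
  apply: eq_bigr => u _; rewrite sum_pair /= (bigD1 u)//= [X in _ + X]big1 ?addr0; last first.
    by move=> v; rewrite eq_sym => /negbTE ->; rewrite big1// => xy _; rewrite mul0r.
  under eq_bigr do rewrite eqxx mul1r.
  rewrite exchange_big; apply: eq_bigr => i _ /=.
  transitivity (\sum_xy PT i xy * (p i * gap i u * PZ i z)).
    by apply: eq_bigr => xy _; ring.
  by rewrite -mulr_suml; have [_ ->] := PTd i; rewrite mul1r.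
under eq_bigr do rewrite -mulr_suml (sum_PEn n PE1) mul1r.
rewrite exchange_big; apply: eq_bigr => i _ /=.
rewrite exchange_big mulr_sumr; apply: eq_bigr => u _ /=.
by rewrite -mulr_sumr; have [_ ->] := PZd i; rewrite mulr1.
Qed.

End MergeProtocol.

Lemma expR_ln2 (R : realType) (k : nat) : 2 ^+ k = expR (k%:R * ln 2) :> R.
Proof. by rewrite expRM_natl lnK// posrE. Qed.

Definition fst_marg (R : realType) (X Y : finType) (p : X * Y -> R) x : R := \sum_y p (x, y).

(** * Block codes for an i.i.d. source *)

Section Achievability.
Variables (R : realType) (X Y Z E : finType) (P : X -> Y -> Z -> R) (PE : E -> R).
Hypotheses (P0 : forall x y z, 0 <= P x y z) (P1 : \sum_x \sum_y \sum_z P x y z = 1).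
Hypothesis PEd : is_dist PE.
Variables (N : nat) (p : 'I_N -> R) (PT : 'I_N -> X * Y -> R) (PZ : 'I_N -> Z -> R).
Hypotheses (pd : is_dist p) (PTd : forall i, is_dist (PT i)) (PZd : forall i, is_dist (PZ i)).
Hypothesis Pdec : forall x y z, P x y z = \sum_(i < N) p i * PT i (x, y) * PZ i z.
Variable label : X -> Y -> 'I_N.
Hypothesis PTlabel : forall i x y, PT i (x, y) != 0 -> label x y = i.

(** Negated conditional entropies in nats: here of X given Y, below of X given the label, where
    [q = 1] leaves just the conditional law. *)
Definition cond_XY_Y : R := llr_mean P (fun x y _ => margXY P (x, y)) (fun _ y _ => margY P y).
Definition cond_X_label : R :=
  llr_mean P (fun x y _ => fst_marg (PT (label x y)) x) (fun _ _ _ => 1).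
Let V3 := llr_var P (fun x y _ => margXY P (x, y)) (fun _ y _ => margY P y).
Let V4 := llr_var P (fun x y _ => fst_marg (PT (label x y)) x) (fun _ _ _ => 1).

Let PT0 i t : 0 <= PT i t. Proof. by have [] := PTd i. Qed.
Let PZ0 i z : 0 <= PZ i z. Proof. by have [] := PZd i. Qed.
Let p0 i : 0 <= p i. Proof. by have [] := pd. Qed.

Lemma label_gt0 x y z : P x y z != 0 -> 0 < PT (label x y) (x, y).
Proof.
move=> Pn0; rewrite lt_neqAle PT0 andbT eq_sym; apply: contraNneq Pn0 => h.
rewrite Pdec big1// => i _; have [->|hi] := eqVneq (PT i (x, y)) 0.
  by rewrite mulr0 mul0r.
by move: (hi); rewrite -(PTlabel hi) h eqxx.
Qed.

Lemma fst_marg_label_gt0 x y z : P x y z != 0 -> 0 < fst_marg (PT (label x y)) x.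
Proof.
move=> /label_gt0 h; apply: lt_le_trans h _.
by rewrite /fst_marg (bigD1 y)//= lerDl sumr_ge0.
Qed.

Section Blocks.
Variable n : nat.
Local Notation labels := (n.-tuple 'I_N).

Let pn (i : labels) : R := \prod_(j < n) p (tnth i j).
Let PTn (i : labels) (t : n.-tuple X * n.-tuple Y) : R :=
  \prod_(j < n) PT (tnth i j) (tnth t.1 j, tnth t.2 j).
Let PZn (i : labels) (z : n.-tuple Z) : R := \prod_(j < n) PZ (tnth i j) (tnth z j).
Let labeln (x : n.-tuple X) (y : n.-tuple Y) : labels :=
  [tuple label (tnth x j) (tnth y j) | j < n].

Let pn_sum : \sum_i pn i = 1.
Proof. by rewrite /pn (sum_tuple_prod (fun=> p)) big1// => j _; case: pd. Qed.

Let PTnd i : is_dist (PTn i).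
Proof.
split=> [t|]; first exact: prodr_ge0.
rewrite sum_pair /PTn (sum2_tuple_prod (fun j x y => PT (tnth i j) (x, y))) big1// => j _.
by rewrite -sum_pair; case: (PTd (tnth i j)).
Qed.

Let PZnd i : is_dist (PZn i).
Proof.
split=> [t|]; first exact: prodr_ge0.
rewrite /PZn (sum_tuple_prod (fun j => PZ (tnth i j))) big1// => j _.
by case: (PZd (tnth i j)).
Qed.

(** A block is again a mixture of the same form, indexed by tuples of labels; these serve as [L] in
    the protocol. *)
Let Pndec x y z : Pn P x y z = \sum_i pn i * PTn i (x, y) * PZn i z.
Proof.
rewrite /Pn; under eq_bigr do rewrite Pdec.
rewrite -(sum_tuple_prod (fun j i => p i * PT i (tnth x j, tnth y j) * PZ i (tnth z j))).
by apply: eq_bigr => i _; rewrite !big_split.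
Qed.

Let PTnlabel i x y : PTn i (x, y) != 0 -> labeln x y = i.
Proof.
move=> /prodf_neq0 h; apply: eq_from_tnth => j; rewrite tnth_mktuple.
by apply: PTlabel; apply: h.
Qed.

Let PXn i x : fst_marg (PTn i) x = \prod_(j < n) fst_marg (PT (tnth i j)) (tnth x j).
Proof. exact: (sum_tuple_prod (fun j y => PT (tnth i j) (tnth x j, y))). Qed.

Let Pn0 : forall x y z, 0 <= @Pn R X Y Z n P x y z.
Proof. by move=> *; apply: Pn_ge0. Qed.

(** Given [y], a typical [x] has conditional probability at least [expR (n * cond_XY_Y - a)], so
    there are at most [expR (a - n * cond_XY_Y)] of them. The hypothesis on [k] provides at least
    [expR a] times as many bins, so collisions cost [expR (- a)]. *)
Lemma exists_decoder (a : R) (k : nat) : 0 < a ->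
  expR (a - n%:R * cond_XY_Y) <= 2 ^+ k * expR (- a) ->
  exists (F : n.-tuple X -> k.-tuple bool) (dec : k.-tuple bool -> n.-tuple Y -> n.-tuple X),
    \sum_x \sum_y margXY (@Pn R X Y Z n P) (x, y) * (dec (F x) y != x)%:R <=
    n%:R * V3 / a ^+ 2 + expR (- a).
Proof.
move=> a0 hk.
(* The decoder needs a default block; one exists because [P] has total mass 1. *)
have [x0|noX] := pickP (predT : pred (n.-tuple X)); last first.
  have := sum_Pn n P1; rewrite big1 => [/eqP|x]; last by have := noX x.
  by rewrite eq_sym oner_eq0.
pose T (x : n.-tuple X) (y : n.-tuple Y) := (margXY (@Pn R X Y Z n P) (x, y) != 0) &&
  (expR (n%:R * cond_XY_Y - a) * margY (@Pn R X Y Z n P) y <= margXY (@Pn R X Y Z n P) (x, y)).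
have [_ XY0 Y0 _] := marg_ge0 Pn0; have [XYge _ XYY _] := marg_ge Pn0.
have K0 : (0 < #|{: k.-tuple bool}|)%N by rewrite card_tuple card_bool expn_gt0.
have [||||F [dec FG]] := @random_binning R (n.-tuple X) (k.-tuple bool) K0 (n.-tuple Y)
    (fun x y => margXY (@Pn R X Y Z n P) (x, y)) T (expR (a - n%:R * cond_XY_Y)) x0.
- by move=> x y; apply: XY0.
- rewrite -(sum_Pn n P1) le_eqVlt; apply/orP; left; apply/eqP.
  by apply: eq_bigr => x _; apply: eq_bigr => y _.
- move=> y; have [h|h] := eqVneq (margY (@Pn R X Y Z n P) y) 0.
    rewrite big1 ?expR_ge0// => x _; rewrite /T.
    have -> : margXY (@Pn R X Y Z n P) (x, y) = 0.
      by apply/eqP; rewrite eq_le XY0 andbT -h XYY.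
    by rewrite eqxx.
  have {}h : 0 < margY (@Pn R X Y Z n P) y by rewrite lt_neqAle eq_sym h Y0.
  apply: (@le_trans _ _ (\sum_x expR (a - n%:R * cond_XY_Y) *
      (margXY (@Pn R X Y Z n P) (x, y) / margY (@Pn R X Y Z n P) y))).
    apply: ler_sum => x _; rewrite /T.
    case: (_ != 0) => /=; last by rewrite mulr_ge0 ?expR_ge0 ?divr_ge0 ?(ltW h).
    have [hz|_] := boolP (_ * margY _ y <= _); last first.
      by rewrite mulr_ge0 ?expR_ge0 ?divr_ge0 ?(ltW h).
    rewrite mulrA ler_pdivlMr// mul1r mulrC -ler_pdivrMr ?expR_gt0//.
    by rewrite -expRN opprB mulrC.
  by rewrite -mulr_sumr -mulr_suml divff ?mulr1// gt_eqF.
- exact: expR_ge0.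
exists F, dec; apply: le_trans FG _; apply: lerD; last first.
  by rewrite card_tuple card_bool natrX ler_pdivrMr ?exprn_gt0// [leRHS]mulrC.
apply: le_trans (llr_concentration n P0 P1 _ _ a0); last 2 first.
- by move=> x y z /(marg_gt0 P0)[].
- by move=> x y z /(marg_gt0 P0)[].
apply: ler_sum => x _; apply: ler_sum => y _; rewrite mulr_suml; apply: ler_sum => z _ /=.
have [->|Pxyz] := eqVneq (Pn P x y z) 0; first by rewrite !mul0r.
rewrite ler_wpM2l// ler_indic// /T.
have [_ _ /lt0r_neq0 -> _ _] := marg_gt0 Pn0 Pxyz.
rewrite /= margXY_Pn margY_Pn negb_and => h; apply/orP; left; exact: h.
Qed.

(** Leftover hashing given the label. The alternative [l = 0] covers an exponent that may be
    negative: the empty key is exactly uniform. *)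
Lemma exists_extractor (a : R) (l : nat) : 0 < a ->
  (l = 0%N \/ 2 ^+ l <= expR (- (n%:R * cond_X_label) - 3 * a)) ->
  exists G : n.-tuple X -> l.-tuple bool,
    \sum_i pn i * \sum_u `|\sum_x fst_marg (PTn i) x * (G x == u)%:R - (2 ^+ l)^-1| <=
    2 * (n%:R * V4 / a ^+ 2) + expR (- a).
Proof.
move=> a0 hl.
have PXn0 i x : 0 <= fst_marg (PTn i) x.
  by apply: sumr_ge0 => y _; have [] := PTnd i.
have PXn1 i : \sum_x fst_marg (PTn i) x = 1 by rewrite -sum_pair; case: (PTnd i).
have pn0 i : 0 <= pn i by apply: prodr_ge0.
pose T (i : labels) (x : n.-tuple X) := fst_marg (PTn i) x <= expR (n%:R * cond_X_label + a).
have tail : \sum_i pn i * \sum_x fst_marg (PTn i) x * (~~ T i x)%:R <= n%:R * V4 / a ^+ 2.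
  apply: le_trans (llr_concentration n P0 P1 _ _ a0); last 2 first.
  - by move=> x y z; apply: fst_marg_label_gt0.
  - by move=> *; exact: ltr01.
  (* The label recovers the mixture index, so averaging over [i] is averaging over the source, where
     Chebyshev's bound is stated. *)
  apply: (@le_trans _ _ (\sum_x \sum_y \sum_z Pn P x y z * (~~ T (labeln x y) x)%:R)).
    rewrite le_eqVlt; apply/orP; left; apply/eqP.
    under eq_bigr do rewrite mulr_sumr.
    rewrite exchange_big; apply: eq_bigr => x _ /=.
    transitivity (\sum_i \sum_y \sum_z pn i * PTn i (x, y) * PZn i z * (~~ T i x)%:R).
      apply: eq_bigr => i _; rewrite /fst_marg mulr_suml mulr_sumr; apply: eq_bigr => y _.
      rewrite -mulr_suml -mulr_sumr; have [_ ->] := PZnd i; by rewrite mulr1 mulrA.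
    rewrite exchange_big; apply: eq_bigr => y _ /=.
    rewrite exchange_big; apply: eq_bigr => z _ /=.
    rewrite Pndec mulr_suml; apply: eq_bigr => i _.
    have [->|h] := eqVneq (PTn i (x, y)) 0; first by rewrite !(mulr0, mul0r).
    by rewrite (PTnlabel h).
  apply: ler_sum => x _; apply: ler_sum => y _; apply: ler_sum => z _ /=.
  rewrite ler_wpM2l// ler_indic// /T PXn negb_and => h; apply/orP; right.
  rewrite [X in _ * X](_ : _ = 1) ?mulr1; last by rewrite /Pn big1.
  apply: contraNN h => h; apply: le_trans h; rewrite le_eqVlt; apply/orP; left; apply/eqP.
  by rewrite /Pn; apply: eq_bigr => j _; rewrite tnth_mktuple.
have [->|l0] := eqVneq l 0%N.
  exists (fun=> [tuple]); rewrite big1 => [|i _]; last first.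
    rewrite big1 ?mulr0// => u _; rewrite expr0 invr1.
    under eq_bigr do rewrite (tuple0 u) eqxx mulr1.
    by rewrite PXn1 subrr normr0.
  rewrite addr_ge0 ?expR_ge0// mulr_ge0//; apply: le_trans tail.
  by apply: sumr_ge0 => i _; rewrite mulr_ge0// sumr_ge0// => x _; rewrite mulr_ge0.
case: hl => [/eqP|hl]; first by rewrite (negbTE l0).
have L0 : (0 < #|{: l.-tuple bool}|)%N by rewrite card_tuple card_bool expn_gt0.
have L2 : #|{: l.-tuple bool}|%:R = 2 ^+ l :> R by rewrite card_tuple card_bool natrX.
have kap0 : 0 < 2 ^+ l * expR a by rewrite mulr_gt0 ?exprn_gt0 ?expR_gt0.
(* With [kap = 2^l * expR a] the term [2^l / kap] is [expR (- a)]. Of the slack [3 * a], one [a]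
   pays for typicality and one for [kap]; the third leaves [kap * d <= expR (- a)]. *)
have [|||||||G hG] := @random_hash R (n.-tuple X) (l.-tuple bool) L0 labels pn
  (fun i x => fst_marg (PTn i) x) T (expR (n%:R * cond_X_label + a)) (2 ^+ l * expR a) => //.
  by rewrite pn_sum.
exists G; rewrite L2 in hG; apply: le_trans hG _; apply: lerD.
  by rewrite ler_wpM2l.
rewrite ler_pdivrMr// mulr_natr mulr2n; apply: lerD.
  apply: (@le_trans _ _ (expR (- (n%:R * cond_X_label) - 3 * a) *
     (expR a * expR (n%:R * cond_X_label + a)))).
    by rewrite -mulrA ler_wpM2r// mulr_ge0 ?expR_ge0.
  by rewrite -!expRD ler_expR; lra.
by rewrite invfM mulrA mulfV ?mul1r ?expRN// expf_neq0.
Qed.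

Lemma exists_protocol (a : R) (k l : nat) : 0 < a ->
  expR (a - n%:R * cond_XY_Y) <= 2 ^+ k * expR (- a) ->
  (l = 0%N \/ 2 ^+ l <= expR (- (n%:R * cond_X_label) - 3 * a)) ->
  exists Pi : protocol R X Y n k l, merges_within Pi P PE
    (2 * (n%:R * V3 / a ^+ 2 + expR (- a)) + (2 * (n%:R * V4 / a ^+ 2) + expR (- a))).
Proof.
move=> a0 hk hl.
have [F [dec Fdec]] := exists_decoder a0 hk.
have [G hG] := exists_extractor a0 hl.
have [PE0 PE1] := PEd.
exists (merge_protocol PTnd labeln F dec G), (fun=> (2 ^+ k)^-1); split.
  exact: unif_msg_dist.
have pn0 i : 0 <= pn i by apply: prodr_ge0.
have h := merge_protocol_err PTnd F dec G P0 PE0 PE1 pn0 PZnd Pndec PTnlabel.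
apply: le_trans h _.
by apply: lerD => //; rewrite ler_wpM2l.
Qed.

End Blocks.
End Achievability.

(** * Rates *)

Section EntropyIdentities.
Variables (R : realType) (X Y Z : finType) (P : X -> Y -> Z -> R).

Definition mean (f : X -> Y -> Z -> R) : R := \sum_x \sum_y \sum_z P x y z * f x y z.

Lemma llr_meanE r q :
  llr_mean P r q = mean (fun x y z => ln (r x y z)) - mean (fun x y z => ln (q x y z)).
Proof.
rewrite /llr_mean /mean -sumrB; apply: eq_bigr => x _.
by rewrite -sumrB; apply: eq_bigr => y _; rewrite -sumrB; apply: eq_bigr => z _; rewrite mulrBr.
Qed.

(** Restricting to the support is what allows logarithms of products to be split, as the factors
    must be positive. *)
Lemma eq_mean f g : (forall x y z, P x y z != 0 -> f x y z = g x y z) -> mean f = mean g.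
Proof.
move=> fg; apply: eq_bigr => x _; apply: eq_bigr => y _; apply: eq_bigr => z _.
by have [->|/fg ->] := eqVneq (P x y z) 0; rewrite ?mul0r.
Qed.

Lemma meanD f g : mean (fun x y z => f x y z + g x y z) = mean f + mean g.
Proof.
rewrite /mean -big_split; apply: eq_bigr => x _; rewrite -big_split; apply: eq_bigr => y _.
by rewrite -big_split; apply: eq_bigr => z _; rewrite mulrDr.
Qed.

Let log2_sum (T : finType) (m : T -> R) : entropy m = - (\sum_t m t * ln (m t)) / ln 2.
Proof.
by rewrite /entropy /log2 mulNr mulr_suml; congr (- _); apply: eq_bigr => t _; rewrite mulrA.
Qed.

Lemma entropy_XY : entropy (margXY P) = - mean (fun x y _ => ln (margXY P (x, y))) / ln 2.
Proof.
rewrite log2_sum sum_pair; congr (- _ / _); do 2 apply: eq_bigr => ? _.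
by rewrite -mulr_suml.
Qed.

Lemma entropy_XZ : entropy (margXZ P) = - mean (fun x _ z => ln (margXZ P (x, z))) / ln 2.
Proof.
rewrite log2_sum sum_pair; congr (- _ / _); apply: eq_bigr => x _.
by rewrite exchange_big; apply: eq_bigr => z _ /=; rewrite -mulr_suml.
Qed.

Lemma entropy_Y : entropy (margY P) = - mean (fun _ y _ => ln (margY P y)) / ln 2.
Proof.
rewrite log2_sum /mean exchange_big; congr (- _ / _); apply: eq_bigr => y _ /=.
by rewrite mulr_suml; apply: eq_bigr => x _; rewrite mulr_suml.
Qed.

Lemma entropy_Z : entropy (margZ P) = - mean (fun _ _ z => ln (margZ P z)) / ln 2.
Proof.
rewrite log2_sum /mean; congr (- _ / _).
under [RHS]eq_bigr do rewrite exchange_big /=.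
rewrite [RHS]exchange_big /=; apply: eq_bigr => z _.
by rewrite mulr_suml; apply: eq_bigr => x _; rewrite mulr_suml.
Qed.

Hypothesis P0 : forall x y z, 0 <= P x y z.

(** I(XY:Z) - I(XZ:Y) in nats: the joint entropy H(XYZ) occurs in both means and cancels. *)
Lemma rate_converseE :
  llr_mean P P (prod_XY_Z P) - llr_mean P P (prod_XZ_Y P) =
  (condH_XgY P - condH_XgZ P) * ln 2.
Proof.
have ln2 : ln 2 != 0 :> R by rewrite gt_eqF// ln_gt0 ?ltr1n.
rewrite !llr_meanE /condH_XgY /condH_XgZ entropy_XY entropy_XZ entropy_Y entropy_Z.
have -> : mean (fun x y z => ln (prod_XY_Z P x y z)) =
    mean (fun x y _ => ln (margXY P (x, y))) + mean (fun _ _ z => ln (margZ P z)).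
  rewrite -meanD; apply: eq_mean => x y z /(marg_gt0 P0)[_ _ ? _ ?].
  by rewrite lnM ?posrE.
have -> : mean (fun x y z => ln (prod_XZ_Y P x y z)) =
    mean (fun x _ z => ln (margXZ P (x, z))) + mean (fun _ y _ => ln (margY P y)).
  rewrite -meanD; apply: eq_mean => x y z /(marg_gt0 P0)[_ ? _ ? _].
  by rewrite lnM ?posrE.
by field.
Qed.

Lemma cond_XY_YE : - cond_XY_Y P = condH_XgY P * ln 2.
Proof.
have ln2 : ln 2 != 0 :> R by rewrite gt_eqF// ln_gt0 ?ltr1n.
by rewrite /cond_XY_Y llr_meanE /condH_XgY entropy_XY entropy_Y; field.
Qed.

Lemma cond_XY_Y_le0 : cond_XY_Y P <= 0.
Proof.
rewrite /cond_XY_Y /llr_mean.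
apply: sumr_le0 => x _; apply: sumr_le0 => y _; apply: sumr_le0 => z _.
have [->|h] := eqVneq (P x y z) 0; first by rewrite mul0r.
have [_ _ xy y0 _] := marg_gt0 P0 h.
rewrite mulr_ge0_le0// subr_le0 ler_ln ?posrE//.
by have [_ _ + _] := marg_ge P0; apply.
Qed.

Variables (N : nat) (p : 'I_N -> R) (PT : 'I_N -> X * Y -> R) (PZ : 'I_N -> Z -> R).
Hypothesis PTd : forall i, is_dist (PT i).
Hypothesis Pdec : forall x y z, P x y z = \sum_(i < N) p i * PT i (x, y) * PZ i z.
Hypothesis PZdisj : forall i j, i != j -> forall z, PZ i z * PZ j z = 0.
Variable label : X -> Y -> 'I_N.
Hypothesis PTlabel : forall i x y, PT i (x, y) != 0 -> label x y = i.

(** On the support [z] determines the label, so the law of X given [z] is its law given the label,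
    and H(X|I) = H(X|Z). *)
Lemma cond_X_labelE : - cond_X_label P PT label = condH_XgZ P * ln 2.
Proof.
have ln2 : ln 2 != 0 :> R by rewrite gt_eqF// ln_gt0 ?ltr1n.
rewrite /cond_X_label llr_meanE /condH_XgZ entropy_XZ entropy_Z.
have -> : mean (fun _ _ _ => ln 1) = 0.
  by rewrite /mean ln1; do 3 (rewrite big1// => ? _); rewrite mulr0.
suff -> : mean (fun x y _ => ln (fst_marg (PT (label x y)) x)) =
    mean (fun x _ z => ln (margXZ P (x, z))) - mean (fun _ _ z => ln (margZ P z)).
  by field.
apply/eqP; rewrite eq_sym subr_eq -meanD; apply/eqP; apply: eq_mean => x y z Pn0.
have PX0 := fst_marg_label_gt0 PTd Pdec PTlabel Pn0.
have [_ xz _ _ z0] := marg_gt0 P0 Pn0.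
rewrite -lnM ?posrE//; congr ln.
set i0 := label x y.
have PZ0 : PZ i0 z != 0.
  apply: contraNneq Pn0 => h; rewrite Pdec big1// => i _.
  have [->|/PTlabel hi] := eqVneq (PT i (x, y)) 0; first by rewrite mulr0 mul0r.
  by rewrite -hi h mulr0.
(* Disjointness on the Z side: [z] selects the single component [i0]. *)
have PE x' y' : P x' y' z = p i0 * PZ i0 z * PT i0 (x', y').
  rewrite Pdec (bigD1 i0)//= big1 ?addr0 => [|i ii0]; first by ring.
  have /eqP := PZdisj ii0 z; rewrite mulf_eq0 (negbTE PZ0) orbF => /eqP ->.
  by rewrite mulr0.
have XZE x' : margXZ P (x', z) = p i0 * PZ i0 z * fst_marg (PT i0) x'.
  by rewrite /margXZ /fst_marg mulr_sumr; apply: eq_bigr => y' _; rewrite PE.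
have -> : margZ P z = p i0 * PZ i0 z.
  have -> : margZ P z = \sum_x' margXZ P (x', z) by [].
  under eq_bigr do rewrite XZE.
  by rewrite -mulr_sumr /fst_marg -sum_pair; have [_ ->] := PTd i0; rewrite mulr1.
by rewrite XZE mulrC.
Qed.

Lemma cond_X_label_le0 : cond_X_label P PT label <= 0.
Proof.
rewrite /cond_X_label /llr_mean.
apply: sumr_le0 => x _; apply: sumr_le0 => y _; apply: sumr_le0 => z _.
have [->|h] := eqVneq (P x y z) 0; first by rewrite mul0r.
rewrite mulr_ge0_le0// ln1 subr0 ln_le0//.
have [PT0 PT1] := PTd (label x y).
rewrite -PT1 sum_pair (bigD1 x)//= lerDl sumr_ge0// => x' _.
by rewrite sumr_ge0.
Qed.

End EntropyIdentities.

Section Scale.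
Variable R : realType.

(** The fourth root of [n + 1]; the shift keeps it at least 1, including at [n = 0]. *)
Definition scale (n : nat) : R := Num.sqrt (Num.sqrt n.+1%:R).

Lemma scale4 n : scale n ^+ 4 = n.+1%:R.
Proof. by rewrite /scale (exprM _ 2 2) !sqr_sqrtr ?sqrtr_ge0. Qed.

Lemma scale_ge1 n : 1 <= scale n.
Proof. by rewrite -(@expr_ge1 _ 4) ?sqrtr_ge0// scale4 ler1n. Qed.

Lemma scale_gt0 n : 0 < scale n.
Proof. exact: lt_le_trans ltr01 (scale_ge1 n). Qed.

Lemma scale_cvg (K : R) : K / scale n @[n --> \oo] --> 0.
Proof.
rewrite -(mulr0 K); apply: cvgMr.
rewrite (_ : (fun n => (scale n)^-1) = Num.sqrt \o (Num.sqrt \o harmonic)); last first.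
  by apply/funext => n; rewrite /scale /harmonic /= !sqrtrV ?sqrtr_ge0.
have sqrt_cvg0 (u : nat -> R) : u n @[n --> \oo] --> 0 ->
    (Num.sqrt \o u) n @[n --> \oo] --> 0.
  move=> u0; rewrite -[X in _ --> X]sqrtr0.
  exact: (cvg_comp _ _ u0 (@sqrt_continuous R 0)).
exact: (sqrt_cvg0 _ (sqrt_cvg0 _ cvg_harmonic)).
Qed.

(* With deviation [a = n^(3/4)], the Chebyshev error [n V / a^2] and [a / n] both vanish. *)
Lemma chebyshev_le (V : R) n : 0 <= V -> n%:R * V / (scale n ^+ 3) ^+ 2 <= V / scale n.
Proof.
move=> V0; have q1 := scale_ge1 n; have q0 := scale_gt0 n.
have nq : n%:R <= scale n ^+ 4 by rewrite scale4 ler_nat.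
rewrite ler_pdivrMr ?exprn_gt0// mulrAC ler_pdivlMr//.
apply: (@le_trans _ _ (scale n ^+ 4 * V * scale n)).
  by rewrite !ler_wpM2r// ltW.
have -> : scale n ^+ 4 * V * scale n = V * scale n ^+ 5 by ring.
by rewrite ler_wpM2l// -exprM ler_weXn2l.
Qed.

(** The factor 2 absorbs [n + 1 <= 2 n]. *)
Lemma rate_le (K c : R) n : (0 < n)%N -> 0 <= K -> c <= K * scale n ^+ 3 ->
  c / n%:R <= 2 * K / scale n.
Proof.
move=> n0 K0 cK; have q1 := scale_ge1 n; have q0 := scale_gt0 n.
have n0' : 0 < n%:R :> R by rewrite ltr0n.
rewrite ler_pdivrMr// (le_trans cK)// mulrAC ler_pdivlMr//.
have -> : K * scale n ^+ 3 * scale n = K * scale n ^+ 4 by ring.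
by rewrite -mulrA mulrCA ler_wpM2l// scale4 -natrM ler_nat mul2n -addnn -addn1 leq_add2l.
Qed.

End Scale.

Lemma llr_var_ge0 (R : realType) (X Y Z : finType) (P r q : X -> Y -> Z -> R) :
  (forall x y z, 0 <= P x y z) -> 0 <= llr_var P r q.
Proof. by move=> P0; do 3 (apply: sumr_ge0 => ? _); rewrite mulr_ge0// sqr_ge0. Qed.

Lemma merges_within_le (R : realType) (X Y Z E : finType) n k l
    (Pi : protocol R X Y n k l) (P : X -> Y -> Z -> R) (PE : E -> R) e1 e2 :
  e1 <= e2 -> merges_within Pi P PE e1 -> merges_within Pi P PE e2.
Proof. by move=> e12 [Q [Qd h]]; exists Q; split=> //; apply: le_trans e12. Qed.

(** * Limits of rates *)

Section Asymptotics.
Variables (R : realType) (X Y Z E : finType) (P : X -> Y -> Z -> R) (PE : E -> R).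
Hypotheses (P0 : forall x y z, 0 <= P x y z) (P1 : \sum_x \sum_y \sum_z P x y z = 1).
Hypothesis PEd : is_dist PE.

Let ln2_gt0 : 0 < ln 2 :> R. Proof. by rewrite ln_gt0 ?ltr1n. Qed.

Lemma converse rho : achievable P PE rho -> condH_XgY P - condH_XgZ P <= rho.
Proof.
move=> [k [l [err [Pi [err0 rate hPi]]]]].
have [_ PE1] := PEd.
set V1 := llr_var P P (prod_XZ_Y P); set V2 := llr_var P P (prod_XY_Z P).
have V10 : 0 <= V1 by apply: llr_var_ge0.
have V20 : 0 <= V2 by apply: llr_var_ge0.
set r0 := condH_XgY P - condH_XgZ P.
(* The slack in the exponents is [2 * a + 3 * ln 2], at most [K * a * ln 2] since [1 <= a]. *)
pose K : R := 2 / ln 2 + 3.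
have K0 : 0 <= K by rewrite addr_ge0// divr_ge0// ltW.
have lim0 : (V1 + V2) / scale R n + err n @[n --> \oo] --> (0 : R).
  by rewrite -[X in _ --> X]addr0; apply: cvgD => //; exact: scale_cvg.
apply: (@ler_cvg_to _ _ _ _ (fun n => r0 - 2 * K / scale R n)
   (fun n => ((k n)%:R - (l n)%:R) / n%:R)) rate _.
  by rewrite -[X in _ --> X]subr0; apply: cvgB; [exact: cvg_cst | exact: scale_cvg].
have small : \forall n \near \oo, (V1 + V2) / scale R n + err n < 1 / 4.
  by apply: (cvgr_lt 0 lim0); rewrite divr_gt0.
near=> n.
have n0 : (0 < n)%N by near: n; exists 1%N.
have sm : (V1 + V2) / scale R n + err n < 1 / 4 by near: n.
have [Q [Qd mQ]] := hPi n.
set a := scale R n ^+ 3; have a0 : 0 < a by rewrite exprn_gt0 ?scale_gt0.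
(* With [kap = 4] the left side loses 1/4; the error and both variance terms together cost less than
   another 1/4. Hence 1/2 is at most 4 times the exponential term, which gives 1/8, that is
   [3 * ln 2] in the exponent. *)
have := converse_oneshot P0 P1 PE1 Qd a0 (ltr0n R 4).
rewrite -/V1 -/V2; set D1 := llr_mean _ _ _; set D2 := llr_mean _ _ _ => h.
have D12 : D2 - D1 = r0 * ln 2 by apply: rate_converseE.
have c1 : n%:R * V1 / a ^+ 2 <= V1 / scale R n by apply: chebyshev_le.
have c2 : n%:R * V2 / a ^+ 2 <= V2 / scale R n by apply: chebyshev_le.
have {}h : 1 / 8 <= 2 ^+ k n * expR (n%:R * D1 + a) * ((2 ^+ l n)^-1 * expR (a - n%:R * D2)).
  rewrite mulrDl in sm; lra.
have e8 : 1 / 8 = expR (- (3 * ln 2)) :> R.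
  by rewrite expRN -(expR_ln2 _ 3) div1r -natrX.
have {}h : - (3 * ln 2) <= (k n)%:R * ln 2 + (n%:R * D1 + a) + (- ((l n)%:R * ln 2) + (a - n%:R * D2)).
  by move: h; rewrite e8 !expR_ln2 -expRN -!expRD ler_expR.
rewrite lerBlDr -lerBlDl -[r0](@mulfK _ n%:R) ?pnatr_eq0 -?lt0n// -mulrBl.
apply: rate_le => //.
have a1 : 1 <= a by rewrite exprn_ege1 ?scale_ge1.
rewrite -(ler_pM2r ln2_gt0) /K -/a.
have -> : (2 / ln 2 + 3) * a * ln 2 = 2 * a + 3 * ln 2 * a.
  by field; rewrite gt_eqF.
have : 3 * ln 2 <= 3 * ln 2 * a by rewrite ler_peMr// mulr_ge0// ltW.
have -> : (r0 * n%:R - ((k n)%:R - (l n)%:R)) * ln 2 =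
  n%:R * (r0 * ln 2) - ((k n)%:R - (l n)%:R) * ln 2 by ring.
by rewrite -D12; lra.
Unshelve. all: by end_near.
Qed.

Lemma achievability : bidisjoint P -> achievable P PE (condH_XgY P - condH_XgZ P).
Proof.
move=> [N [p [PT [PZ [pd PTd PZd Pdec disj]]]]].
have [i0 _|noI] := pickP (predT : pred 'I_N); last first.
  have := pd.2; rewrite big1 => [/esym/eqP|i _]; last by have := noI i.
  by rewrite oner_eq0.
(* Disjointness on the XY side makes the component unique; [i0] is only the value where no component
   is positive. *)
pose label x y := odflt i0 [pick i | PT i (x, y) != 0].
have PTlabel i x y : PT i (x, y) != 0 -> label x y = i.
  move=> hi; rewrite /label; case: pickP => [j hj|/(_ i)] /=; last by rewrite hi.
  apply/eqP; apply: contraT => ji; have /eqP := (disj _ _ ji).1 (x, y).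
  by rewrite mulf_eq0 (negbTE hi) (negbTE hj).
have PZdisj i j : i != j -> forall z, PZ i z * PZ j z = 0 by move=> /disj[].
have D3E := cond_XY_YE P; have D3le := cond_XY_Y_le0 P0.
have D4E := cond_X_labelE P0 PTd Pdec PZdisj PTlabel.
have D4le := cond_X_label_le0 P0 PTd label.
have exP := @exists_protocol R X Y Z E P PE P0 P1 PEd N p PT PZ pd PTd PZd Pdec label PTlabel.
move: D3E D3le D4E D4le exP.
set D3 := cond_XY_Y P; set D4 := cond_X_label P PT label.
set V3 := llr_var _ _ _; set V4 := llr_var _ _ _ => D3E D3le D4E D4le exP.
have V30 : 0 <= V3 by apply: llr_var_ge0.
have V40 : 0 <= V4 by apply: llr_var_ge0.
pose a n : R := scale R n ^+ 3.
have a0 n : 0 < a n by rewrite exprn_gt0 ?scale_gt0.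
have a1 n : 1 <= a n by rewrite exprn_ege1 ?scale_ge1.
(* Solutions of the two conditions of [exists_protocol]: the decoder asks for [2 * a] above n
   H(X|Y), the extractor for [3 * a] below n H(X|Z), in nats. *)
pose xk n := (2 * a n - n%:R * D3) / ln 2.
pose xl n := (- (n%:R * D4) - 3 * a n) / ln 2.
(* [k] is rounded up and [l] down; a negative [xl] truncates to 0, which is the case [l = 0] of the
   extractor. *)
pose k n := (Num.trunc (xk n)).+1; pose l n := Num.trunc (xl n).
have nD3 n : n%:R * D3 <= 0 by rewrite mulr_ge0_le0.
have nD4 n : n%:R * D4 <= 0 by rewrite mulr_ge0_le0.
have xk0 n : 0 <= xk n.
  by rewrite divr_ge0 ?(ltW ln2_gt0)// subr_ge0 (le_trans (nD3 n))// mulr_ge0// ltW.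
have kP n : xk n <= (k n)%:R <= xk n + 1.
  have /andP[h1 h2] := truncn_itv (xk0 n).
  by rewrite (ltW h2)/= /k -natr1 lerD2r.
have lP n : xl n - 1 <= (l n)%:R <= - (n%:R * D4) / ln 2.
  rewrite lerBlDr natr1 (ltW (truncnS_gt _)) /=.
  have [h|h] := leP 0 (xl n).
    have /andP[h1 _] := truncn_itv h; apply: le_trans h1 _.
    by rewrite ler_pM2r ?invr_gt0// gerBl mulr_ge0// ltW.
  rewrite /l (truncn0Pn _ _) ?divr_ge0 ?oppr_ge0 ?(ltW ln2_gt0)//.
  by rewrite -ltNge (lt_trans h).
(* The 3 collects the three terms [expR (- a n)], each at most [1 / scale R n]. *)
pose err n := (2 * V3 + 2 * V4 + 3) / scale R n.
have Pin n : exists Pi : protocol R X Y n (k n) (l n), merges_within Pi P PE (err n).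
  have [||Pi hPi] := exP n (a n) (k n) (l n) (a0 n).
  - rewrite expR_ln2 -expRD ler_expR.
    have /andP[+ _] := kP n; rewrite /xk ler_pdivrMr//; lra.
  - have [h|h] := leP 1 (xl n); last by left; apply/truncn0Pn; rewrite -ltNge.
    right; rewrite expR_ln2 ler_expR -ler_pdivlMr//.
    by have /andP[] := truncn_itv (le_trans ler01 h).
  exists Pi; apply: merges_within_le hPi.
  have c3 : n%:R * V3 / a n ^+ 2 <= V3 / scale R n by apply: chebyshev_le.
  have c4 : n%:R * V4 / a n ^+ 2 <= V4 / scale R n by apply: chebyshev_le.
  have ea : expR (- a n) <= 1 / scale R n.
    rewrite expRN div1r lef_pV2 ?posrE ?expR_gt0 ?scale_gt0//.
    rewrite (le_trans _ (expR_ge1Dx _))//.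
    apply: (@le_trans _ _ (a n)); last by rewrite lerDr.
    by rewrite ler_eXnr ?scale_ge1.
  rewrite /err !mulrDl -!mulrA; lra.
pose Pi n := projT1 (cid (Pin n)).
exists k, l, err, Pi; split.
- exact: scale_cvg.
- set r0 := condH_XgY P - condH_XgZ P.
  (* The deviations [2 * a] in [xk] and [3 * a] in [xl] add up to 5; the 2 pays for two roundings,
     each at most [1 <= a]. *)
  pose K : R := 5 / ln 2 + 2.
  have K0 : 0 <= K by rewrite addr_ge0// divr_ge0// ltW.
  (* Key use is rounded up and key yield down, so the rate lies above [r0] and only the upper side
     needs a vanishing correction. *)
  apply: (@squeeze_cvgr _ _ _ _ (fun=> r0) (fun n => r0 + 2 * K / scale R n)).
  + near=> n.
    have n0 : (0 < n)%N by near: n; exists 1%N.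
    have n0' : 0 < n%:R :> R by rewrite ltr0n.
    have r0E : r0 * n%:R = (- (n%:R * D3) + n%:R * D4) / ln 2.
      rewrite /r0 -!mulrN D3E.
      have -> : n%:R * D4 = - (n%:R * (condH_XgZ P * ln 2)) by rewrite -D4E mulrN opprK.
      by field; rewrite gt_eqF.
    have /andP[k1 k2] := kP n; have /andP[l1 l2] := lP n.
    have E1 : xk n = - (n%:R * D3) / ln 2 + 2 * a n / ln 2.
      by rewrite /xk -mulrDl addrC.
    have E2 : xl n = - (n%:R * D4) / ln 2 - 3 * a n / ln 2.
      by rewrite /xl mulrBl.
    have E3 : r0 * n%:R = - (n%:R * D3) / ln 2 - - (n%:R * D4) / ln 2.
      by rewrite r0E -mulrBl opprK.
    have al0 : 0 <= a n / ln 2 by rewrite divr_ge0// ltW.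
    apply/andP; split.
      rewrite ler_pdivlMr// E3; lra.
    rewrite -lerBlDl -[r0](@mulfK _ n%:R) ?gt_eqF// -mulrBl.
    apply: rate_le => //; rewrite -/(a n) /K E3.
    have -> : (5 / ln 2 + 2) * a n = 5 * (a n / ln 2) + 2 * a n by ring.
    have := a1 n; lra.
  + exact: cvg_cst.
  + rewrite -[X in _ --> X]addr0; apply: cvgD; [exact: cvg_cst | exact: scale_cvg].
- by move=> n; rewrite /Pi; case: cid.
Unshelve. all: by end_near.
Qed.

End Asymptotics.

Theorem theorem1 (R : realType) (X Y Z E : finType)
    (P : X -> Y -> Z -> R) (PE : E -> R) :
  is_dist (fun t : X * Y * Z => P t.1.1 t.1.2 t.2) ->
  is_dist PE ->
  bidisjoint P ->
  [/\ mi_XZ P - mi_XY P = condH_XgY P - condH_XgZ P,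
      achievable P PE (mi_XZ P - mi_XY P) &
      forall rho : R, achievable P PE rho -> mi_XZ P - mi_XY P <= rho].
Proof.
move=> [P0' P1'] PEd Pbi.
have P0 x y z : 0 <= P x y z by exact: (P0' (x, y, z)).
have P1 : \sum_x \sum_y \sum_z P x y z = 1 by rewrite -sum_triple.
have rateE : mi_XZ P - mi_XY P = condH_XgY P - condH_XgZ P.
  by rewrite /mi_XZ /mi_XY /condH_XgY /condH_XgZ; ring.
rewrite rateE; split=> //; first exact: achievability.
by move=> rho; apply: converse.
Qed.
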